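(* A sorted list of $n$ integers from the universe $[0,m-1]$ can be represented either simply as an array $A[1..n]$ containing the integers in sorted order, or as an array of $n$ integers (occupying the same number of bits) whose last $n\lg n-2n$ bits are all zero. Moreover, there is an in-place algorithm running in $O(n)$ time that switches between these two formats (in either direction).
   Context: Model: word RAM; an array of $n$ integers from $[0,m-1]$ occupies $n\lceil\lg m\rceil$ bits. ''In-place'' means the algorithm operates within the array itself, using only $O(\lg n)$ bits of extra working space.
   Formalization: The formal theorem assumes n ≥ 1 and n ≤ 2^⌈lg m⌉ (implied by n ≤ m); without such a bound the claim fails, e.g. for n = 16, m = 2 the array has only 16 bits but 32 trailing zero bits would be required. *)

(* Defs.v *)
From mathcomp Require Import all_boot.

Set Implicit Arguments.
Unset Strict Implicit.
Unset Printing Implicit Defensive.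

(** Word RAM whose only addressable memory is the given array: [n] cells of
    [b] bits each.  Everything else a program can write to is its registers,
    whose total size in bits is the extra working space.  [n] and [b] are
    read-only inputs.  There is no separate word-size parameter: a run whose
    registers stay within [s] bits is a run on a word RAM with words of
    [maxn b s] bits, since an instruction touches one cell, the registers it
    names and the inputs, and arithmetic never has to wrap around. *)

Inductive operand :=
  | Reg of nat
  | Imm of nat
  | ArrayLen
  | CellBits.

Inductive binop := Add | Sub | Mul | Div | Mod | Shl | Shr | And | Or | Xor.

(** In [Read] and [Write], the accessed field of cell [i] consists of its [len]
    bits of significance [base - disp], ..., [base - disp + len - 1].  Two
    operands are used for the offset so that a position relative to the most
    significant end of a cell ([base := CellBits]) need not be computed into a
    register. *)
Inductive instr :=
  | Op (o : binop) (d : nat) (x y : operand)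
  | Read (d : nat) (i base disp len : operand)
  | Write (i base disp len v : operand)
  | Jlt (x y : operand) (target : nat)
  | Jeq (x y : operand) (target : nat).

Definition program := seq instr.

Record config := Config { pc : nat; regs : seq nat; cells : seq nat }.

Definition binop_eval (o : binop) (x y : nat) : nat :=
  match o with
  | Add => x + y
  | Sub => x - y
  | Mul => x * y
  | Div => x %/ y
  | Mod => x %% y
  | Shl => x * 2 ^ y
  | Shr => x %/ 2 ^ y
  | And => Nat.land x y
  | Or => Nat.lor x y
  | Xor => Nat.lxor x y
  end.

Definition get_field (x off len : nat) : nat := (x %/ 2 ^ off) %% 2 ^ len.

Definition set_field (x off len v : nat) : nat :=
  x %/ 2 ^ (off + len) * 2 ^ (off + len) + v %% 2 ^ len * 2 ^ off
  + x %% 2 ^ off.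

Section Semantics.

Variables (p : program) (n b : nat).

Definition operand_eval (rs : seq nat) (x : operand) : nat :=
  match x with
  | Reg r => nth 0 rs r
  | Imm c => c
  | ArrayLen => n
  | CellBits => b
  end.

(** [None]: the control has left the program, or an access falls outside the
    array or outside the cell. *)
Definition step (c : config) : option config :=
  let: Config k rs a := c in
  let ev := operand_eval rs in
  match onth p k with
  | None => None
  | Some (Op o d x y) =>
      Some (Config k.+1 (set_nth 0 rs d (binop_eval o (ev x) (ev y))) a)
  | Some (Read d i base disp len) =>
      let off := ev base - ev disp in
      if (ev i < n) && (off + ev len <= b) then
        Some (Config k.+1
          (set_nth 0 rs d (get_field (nth 0 a (ev i)) off (ev len))) a)
      else None
  | Some (Write i base disp len v) =>
      let off := ev base - ev disp in
      if (ev i < n) && (off + ev len <= b) then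
        Some (Config k.+1 rs
          (set_nth 0 a (ev i)
            (set_field (nth 0 a (ev i)) off (ev len) (ev v))))
      else None
  | Some (Jlt x y l) => Some (Config (if ev x < ev y then l else k.+1) rs a)
  | Some (Jeq x y l) => Some (Config (if ev x == ev y then l else k.+1) rs a)
  end.

Definition run (a : seq nat) (k : nat) : option config :=
  iter k (obind step) (Some (Config 0 [::] a)).

Definition halted (c : config) : bool := size p <= pc c.

(** [up_log 2 v.+1] is the length of [v] in binary. *)
Definition space (c : config) : nat := \sum_(v <- regs c) up_log 2 v.+1.

Definition transforms_within (time bits : nat) (a a' : seq nat) : Prop :=
  exists k : nat,
    [/\ k <= time,
        exists c, [/\ run a k = Some c, halted c & cells c = a'] &
        forall j c, j <= k -> run a j = Some c -> space c <= bits].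

End Semantics.

Definition lg_ceil (m : nat) : nat := up_log 2 m.

Definition sorted_list (n m : nat) (a : seq nat) : bool :=
  [&& size a == n, all (fun x => x < m) a & sorted leq a].

Definition is_array (n b : nat) (a : seq nat) : bool :=
  (size a == n) && all (fun x => x < 2 ^ b) a.

(** Bit [q] of the array: the cells are laid out consecutively, each with its
    least significant bit first. *)
Definition array_bit (b : nat) (a : seq nat) (q : nat) : bool :=
  odd (nth 0 a (q %/ b) %/ 2 ^ (q %% b)).

Definition last_bits_zero (n b t : nat) (a : seq nat) : Prop :=
  forall q, n * b - t <= q < n * b -> array_bit b a q = false.

(** The ceiling of [n lg n - 2 n] (and 0 if this is negative), as
    [n lg n = lg (n ^ n)]. *)
Definition spare_bits (n : nat) : nat := lg_ceil (n ^ n) - 2 * n.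

Definition compact_format (n b : nat) (a : seq nat) : Prop :=
  is_array n b a /\ last_bits_zero n b (spare_bits n) a.

(* Main.v *)
Require Import Defs.
From mathcomp Require Import all_boot ssralg ssrnum ssrint zify.

Set Implicit Arguments.
Unset Strict Implicit.
Unset Printing Implicit Defensive.

(** Let [t = lg_ceil n] and let [h_c] be the [t] most significant bits of cell
    [c]; the sequence [h] is sorted, so it is determined by the set of the
    positions [c + h_c], a bit vector of fewer than [n + 2 ^ t <= 3 n] bits.
    To build it in place, note that the three leading bits of [h_c] are a
    sorted sequence of digits: seven counters kept in registers determine it,
    which frees three bits per cell to hold the bit vector, bit [k] going to
    plane [k %/ n] of cell [k %% n].  Once the rest of [h] is erased, every
    cell [c] has a hole of [t - 2] or [t - 3] bits at its most significant end,
    [n t - n - 2 ^ t] bits altogether, which by AM-GM is at least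
    [n lg n - 2 n].

    The holes are then gathered at the end of the array by filling them, from
    the first cell on, with the data of the last cells.  Every chunk copied
    completes a hole or empties a cell, so that [n - 1] copies suffice, and the
    schedule of these copies only depends on [n] and [b]: decompression replays
    it in the other direction, then reads the bit vector.

    Copying a whole cell would not do, since [b] may exceed any multiple of
    [lg n]: positions are therefore measured from the most significant end of
    a cell. *)

(** * Bits of a number *)

Definition bit (x s : nat) : bool := odd (x %/ 2 ^ s).

Lemma bit_half x s : bit x s.+1 = bit x./2 s.
Proof. by rewrite /bit expnS divnMA divn2. Qed.

Lemma bit_ext x y : (forall s, bit x s = bit y s) -> x = y.
Proof.
have [k] := ubnP (x + y); elim: k x y => // k IHk x y le_k eq_xy.
have [xy0 | xy_gt0] := posnP (x + y); first by lia.
have := eq_xy 0; rewrite /bit expn0 !divn1 => odd_xy.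
suff half_xy : x./2 = y./2.
  by rewrite -[x]odd_double_half -[y]odd_double_half odd_xy half_xy.
apply: IHk => [|s]; last by rewrite -!bit_half.
by have := odd_double_half x; have := odd_double_half y; lia.
Qed.

Lemma bit_lt x w s : x < 2 ^ w -> w <= s -> bit x s = false.
Proof.
by move=> lt_x le_w; rewrite /bit divn_small // (leq_trans lt_x) // leq_exp2l.
Qed.

Lemma bit_mod x w s : bit (x %% 2 ^ w) s = (s < w) && bit x s.
Proof.
have [lt_s | le_w] := ltnP s w; last by rewrite (bit_lt _ le_w) // ltn_pmod ?expn_gt0.
rewrite {2}(divn_eq x (2 ^ w)) /bit /=.
(* An even multiple of [2 ^ s] does not change the parity of the quotient by [2 ^ s]. *)
have -> : 2 ^ w = (2 ^ (w - s.+1)).*2 * 2 ^ s.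
  by rewrite -mul2n -expnS -expnD; congr (2 ^ _); lia.
by rewrite mulnA divnMDl ?expn_gt0 // oddD oddM odd_double andbF.
Qed.

Lemma bit_div x w s : bit (x %/ 2 ^ w) s = bit x (w + s).
Proof. by rewrite /bit -divnMA -expnD. Qed.

Lemma bit_mulX x w s : bit (x * 2 ^ w) s = (w <= s) && bit x (s - w).
Proof.
rewrite /bit; have [le_w | lt_s] := leqP w s.
  by rewrite -{1}(subnK le_w) expnD divnMr ?expn_gt0.
have -> : 2 ^ w = (2 ^ (w - s.+1)).*2 * 2 ^ s.
  by rewrite -mul2n -expnS -expnD; congr (2 ^ _); lia.
by rewrite mulnA mulnK ?expn_gt0 // oddM odd_double andbF.
Qed.

Lemma lt_exp2_bit x w : (forall s, w <= s -> bit x s = false) -> x < 2 ^ w.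
Proof.
move=> x0; suff -> : x = x %% 2 ^ w by rewrite ltn_pmod ?expn_gt0.
apply: bit_ext => s; rewrite bit_mod.
by case: ltnP => // /x0.
Qed.

Lemma bit_addX x y w s : y < 2 ^ w ->
  bit (x * 2 ^ w + y) s = if s < w then bit y s else bit x (s - w).
Proof.
move=> lt_y; case: ltnP => [lt_s | le_w].
  rewrite -[in RHS](modn_small lt_y) -(modnMDl x) bit_mod lt_s //.
by rewrite -{1}(subnKC le_w) -bit_div divnMDl ?expn_gt0 // divn_small // addn0.
Qed.

Lemma bit_get x off len s :
  bit (get_field x off len) s = (s < len) && bit x (off + s).
Proof. by rewrite /get_field bit_mod bit_div. Qed.

Lemma bit_set x off len v s :
  bit (set_field x off len v) s =
  if (off <= s) && (s < off + len) then bit v (s - off) else bit x s.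
Proof.
have -> : set_field x off len v =
    (x %/ 2 ^ (off + len) * 2 ^ len + v %% 2 ^ len) * 2 ^ off + x %% 2 ^ off.
  by rewrite /set_field mulnDl -mulnA -expnD [len + off]addnC.
rewrite bit_addX ?ltn_pmod ?expn_gt0 // bit_mod.
case: ltnP => /= [lt_s|le_s]; first by [].
rewrite bit_addX ?ltn_pmod ?expn_gt0 // bit_mod.
have -> : (s < off + len) = (s - off < len) by lia.
by case: ltnP => // le_s2; rewrite bit_div; congr bit; lia.
Qed.

Lemma bit0 s : bit 0 s = false.
Proof. by rewrite /bit div0n. Qed.

Lemma bit1 s : bit 1 s = (s == 0).
Proof. by case: s => [|s]; rewrite // bit_half bit0. Qed.

Definition cell_bit (a : seq nat) (c s : nat) : bool := bit (nth 0 a c) s.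

Lemma cell_bit_set a c x c' s :
  cell_bit (set_nth 0 a c x) c' s = if c' == c then bit x s else cell_bit a c' s.
Proof. by rewrite /cell_bit nth_set_nth /=; case: eqP. Qed.

Lemma cell_bit_write a c off len v c' s :
  cell_bit (set_nth 0 a c (set_field (nth 0 a c) off len v)) c' s =
  if [&& c' == c, off <= s & s < off + len] then bit v (s - off)
  else cell_bit a c' s.
Proof.
rewrite cell_bit_set; case: eqP => [-> | //]; rewrite bit_set /=.
by case: ifP.
Qed.

Lemma cell_bit_ge n b a c s : is_array n b a -> b <= s -> cell_bit a c s = false.
Proof.
move=> /andP[_ /all_nthP lt_a] le_b; rewrite /cell_bit.
have [lt_c|le_c] := ltnP c (size a); first by rewrite (bit_lt (lt_a 0 c lt_c)).
by rewrite nth_default // bit0.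
Qed.

Lemma is_array_write n b a c off len v :
  is_array n b a -> c < n -> off + len <= b ->
  is_array n b (set_nth 0 a c (set_field (nth 0 a c) off len v)).
Proof.
move=> a_arr lt_c le_b; have /andP[/eqP sz _] := a_arr; apply/andP; split.
  by rewrite size_set_nth sz; apply/eqP; lia.
apply/(all_nthP 0) => c' _; apply: lt_exp2_bit => s le_s.
rewrite -/(cell_bit _ _ _) cell_bit_write ifN ?(cell_bit_ge _ a_arr) //; lia.
Qed.

Lemma is_array_ext n b a a' : is_array n b a -> is_array n b a' ->
  (forall c s, c < n -> s < b -> cell_bit a c s = cell_bit a' c s) -> a = a'.
Proof.
move=> a_arr a'_arr eq_aa'.
have /andP[/eqP sz _] := a_arr; have /andP[/eqP sz' _] := a'_arr.
apply: (@eq_from_nth _ 0) => [|c]; rewrite sz ?sz' // => lt_c.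
apply: bit_ext => s; have [lt_s | le_s] := ltnP s b; first exact: eq_aa'.
by rewrite -!/(cell_bit _ _ _) (cell_bit_ge _ a_arr) // (cell_bit_ge _ a'_arr).
Qed.

(* AM-GM for [r] numbers equal to 2 and [n - r] numbers equal to 1. *)
Lemma exp_add_ge n r : r <= n -> 2 ^ r * n ^ n <= (n + r) ^ n.
Proof.
move=> le_rn; have [n0 | n_gt0] := posnP n.
  by move: le_rn; rewrite n0 leqn0 => /eqP->.
pose f (i : 'I_n) := if i < r then 2 else 1.
have cardr : #|[pred i : 'I_n | i < r]| = r.
  rewrite -sum1_card; under eq_bigl do rewrite inE.
  by rewrite -(big_ord_widen n (fun=> 1) le_rn) sum1_card card_ord.
have prodf : \prod_i f i = 2 ^ r.
  by rewrite /f -big_mkcond prod_nat_const cardr.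
have sumf : \sum_i f i = n + r.
  rewrite /f (eq_bigr (fun i : 'I_n => 1 + (i < r))); last by move=> i _; case: ifP.
  rewrite big_split /= sum1_card card_ord; congr (_ + _).
  rewrite -[RHS]cardr -sum1_card [RHS]big_mkcond.
  by apply: eq_bigr => i _; rewrite inE; case: ifP.
have f_ge0 : {in predT, forall i, (0 <= Posz (f i) *+ #|'I_n|)%R}.
  by move=> i _; apply: Num.Theory.mulrn_wge0.
have [le_prod _] := Num.Theory.leif_AGM_scaled f_ge0.
(* The scaled inequality multiplies every number by [n], which produces the factor [n ^ n]. *)
move: le_prod; rewrite card_ord (eq_bigr (fun i => Posz (f i * n))); last first.
  by move=> i _; rewrite -GRing.mulr_natr PoszM natz.
rewrite -(big_morph Posz PoszM erefl) -(big_morph Posz PoszD erefl).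
rewrite big_split /= prodf sumf prod_nat_const card_ord.
by rewrite -[Posz _ in X in (_ <= X)%R]natz -GRing.natrX natz lez_nat.
Qed.

(** AM-GM with [r = 2 ^ t - n] gives [2 ^ r * n ^ n <= 2 ^ (t * n)], so [n * t - r] bits suffice for
    [n ^ n]. This is what bounds the spare bits by the total size of the holes. *)
Lemma up_log_exp_le n t : 2 ^ t <= n.*2 -> n <= 2 ^ t ->
  up_log 2 (n ^ n) <= n * t + n - 2 ^ t.
Proof.
move=> le_2n le_n; apply: up_log_min => //.
have le_r : 2 ^ t - n <= n by lia.
have := exp_add_ge le_r; rewrite subnKC // -expnM.
rewrite mulnC -leq_divRL ?expn_gt0 // => /leq_trans -> //.
(* The truncated subtractions are exact, since [2 ^ t <= n * t + n]. *)
have -> : t * n = (n * t + n - 2 ^ t) + (2 ^ t - n).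
  have : 2 ^ t <= n * t + n; last by lia.
  by case: t le_2n {le_r le_n} => [|t] le_2n; [rewrite expn0; lia | nia].
by rewrite expnD mulnK ?expn_gt0.
Qed.

(** * Bounded runs of structured programs *)

Definition small (R e : nat) (rs : seq nat) : bool :=
  (size rs <= R) && all (fun v => v < 2 ^ e) rs.

Lemma small_nth R e rs r : small R e rs -> nth 0 rs r < 2 ^ e.
Proof.
move=> /andP[_ /all_nthP lt_rs]; have [/lt_rs // | ?] := ltnP r (size rs).
by rewrite nth_default // expn_gt0.
Qed.

Lemma small_set R e rs d v :
  d < R -> v < 2 ^ e -> small R e rs -> small R e (set_nth 0 rs d v).
Proof.
move=> lt_d lt_v rs_small; have /andP[le_sz _] := rs_small; apply/andP; split.
  by rewrite size_set_nth; lia.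
apply/(all_nthP 0) => i _; rewrite nth_set_nth /=.
by case: eqP => // _; apply: small_nth rs_small.
Qed.

Lemma small_widen R e e' rs : e <= e' -> small R e rs -> small R e' rs.
Proof.
move=> le_e /andP[le_sz lt_rs]; rewrite /small le_sz; apply: sub_all lt_rs => v /leq_trans; apply.
by rewrite leq_exp2l.
Qed.

Lemma small_space R e k rs a : small R e rs -> space (Config k rs a) <= R * e.
Proof.
move=> /andP[le_sz lt_rs]; apply: leq_trans (_ : size rs * e <= _); last first.
  by rewrite leq_mul2r le_sz orbT.
rewrite /space /= {le_sz}; elim: rs lt_rs => [|v rs IHrs] /=; first by rewrite big_nil.
move=> /andP[lt_v lt_rs]; rewrite big_cons mulSn leq_add ?IHrs //.
exact: up_log_min.
Qed.

Section Reach.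

Variables (p : program) (n b : nat).

Definition reach (T S : nat) (c c' : config) : Prop :=
  exists k, [/\ k <= T, iter k (obind (step p n b)) (Some c) = Some c' &
    forall j d, j <= k -> iter j (obind (step p n b)) (Some c) = Some d ->
      space d <= S].

Lemma reach_refl S c : space c <= S -> reach 0 S c c.
Proof.
move=> le_c; exists 0; split=> // j d.
by rewrite leqn0 => /eqP-> [<-].
Qed.

Lemma reach_step S c c' :
  step p n b c = Some c' -> space c <= S -> space c' <= S -> reach 1 S c c'.
Proof.
move=> st le_c le_c'; exists 1; split=> // [] [|[|j]] d //= _; first by case=> <-.
by rewrite st => -[<-].
Qed.

Lemma reach_trans T1 T2 S c c' c'' :
  reach T1 S c c' -> reach T2 S c' c'' -> reach (T1 + T2) S c c''.
Proof.
move=> [k1 [le1 it1 sp1]] [k2 [le2 it2 sp2]]; exists (k2 + k1); split.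
- by lia.
- by rewrite iterD it1.
move=> j d le_j; have [lt_j|le_k1] := ltnP j k1; first by apply: sp1; lia.
rewrite -(subnK le_k1) iterD it1; apply: sp2; lia.
Qed.

Lemma reach_le T T' S c c' : T <= T' -> reach T S c c' -> reach T' S c c'.
Proof. by move=> le_T [k [le_k ? ?]]; exists k; split=> //; lia. Qed.

End Reach.

(** [CellBits] is excluded because [b] is not bounded in terms of [n] and must not reach a register.
    It may still be subtracted or serve as a divisor: the result is then bounded by the first
    operand alone. *)
Definition tame_operand (x : operand) : bool :=
  match x with Imm c => c <= 8 | CellBits => false | _ => true end.

Definition tame_instr (R : nat) (i : instr) : bool :=
  match i with
  | Op Add d x y | Op Mul d x y => [&& d < R, tame_operand x & tame_operand y]
  | Op Defs.Sub d x _ | Op Div d x _ | Op Mod d x _ => (d < R) && tame_operand x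
  | Read d _ _ _ _ => d < R
  | Write _ _ _ _ _ => true
  | _ => false
  end.

(* Registers below [2 ^ e] are below [2 ^ grow i e] after the tame
   instruction [i]. *)
Definition grow (i : instr) (e : nat) : nat :=
  match i with Op Add _ _ _ => e.+1 | Op Mul _ _ _ => e + e | _ => e end.

Fixpoint grow_block (l : seq instr) (e : nat) : nat :=
  if l is i :: l' then grow_block l' (grow i e) else e.

Lemma leq_grow i e : e <= grow i e.
Proof. by case: i => // -[] /=; lia. Qed.

Lemma leq_grow_block l e : e <= grow_block l e.
Proof. by elim: l e => //= i l IHl e; apply: leq_trans (leq_grow i e) _. Qed.

(* Weakest precondition of a straight-line block; reads are restricted to
   fields of at most [w] bits, which bounds the values loaded. *)
Fixpoint wp (n b w : nat) (l : seq instr) (Q : seq nat -> seq nat -> Prop)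
    (rs a : seq nat) : Prop :=
  match l with
  | [::] => Q rs a
  | Op o d x y :: l' =>
      forall v, v = binop_eval o (operand_eval n b rs x) (operand_eval n b rs y) ->
      wp n b w l' Q (set_nth 0 rs d v) a
  | Read d i base disp len :: l' =>
      let ev := operand_eval n b rs in
      let off := ev base - ev disp in
      [/\ ev i < n, off + ev len <= b, ev len <= w &
        forall v, v = get_field (nth 0 a (ev i)) off (ev len) ->
        wp n b w l' Q (set_nth 0 rs d v) a]
  | Write i base disp len x :: l' =>
      let ev := operand_eval n b rs in
      let off := ev base - ev disp in
      [/\ ev i < n, off + ev len <= b &
        forall a', a' = set_nth 0 a (ev i)
          (set_field (nth 0 a (ev i)) off (ev len) (ev x)) ->
        wp n b w l' Q rs a']
  | _ => False
  end.

Definition code_at (p : program) (k : nat) (l : seq instr) : Prop :=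
  forall j, j < size l -> onth p (k + j) = onth l j.

Lemma code_at_cons p k i l :
  code_at p k (i :: l) -> onth p k = Some i /\ code_at p k.+1 l.
Proof.
move=> code; split=> [|j lt_j]; first by have := code 0 isT; rewrite addn0.
by rewrite addSnnS code.
Qed.

Lemma code_at_cat p k l1 l2 :
  code_at p k (l1 ++ l2) -> code_at p k l1 /\ code_at p (k + size l1) l2.
Proof.
move=> code; split=> j lt_j.
  by rewrite code ?size_cat ?onth_cat ?lt_j //; lia.
rewrite -addnA code ?size_cat ?ltn_add2l // onth_cat ifN; last by lia.
by congr onth; lia.
Qed.

Inductive seg := Blk of seq instr | Loop of operand & operand & seq instr.

(** Jump targets are absolute, hence the address [k]; comparing 0 with itself is an unconditional
    jump. *)
Definition seg_code (k : nat) (s : seg) : seq instr :=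
  match s with
  | Blk l => l
  | Loop x y l =>
      Jlt x y (k + 2) :: Jeq (Imm 0) (Imm 0) (k + size l + 3) ::
      l ++ [:: Jeq (Imm 0) (Imm 0) k]
  end.

Fixpoint segs_code (k : nat) (ss : seq seg) : seq instr :=
  if ss is s :: ss' then
    seg_code k s ++ segs_code (k + size (seg_code k s)) ss'
  else [::].

Lemma segs_code_cat k ss1 ss2 :
  segs_code k (ss1 ++ ss2) =
  segs_code k ss1 ++ segs_code (k + size (segs_code k ss1)) ss2.
Proof.
elim: ss1 k => [|s ss1 IHss] k /=; first by rewrite addn0.
by rewrite IHss -catA size_cat addnA.
Qed.

Section Triples.

(* [e] bounds the registers between blocks, [E] inside them. *)
Variables (n b w R e E : nat).
Hypotheses (e_gt3 : 3 < e) (n_lt : n < 2 ^ e) (w_le : w <= e).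

Definition config_reach (T : nat) (p : program) (k k' : nat)
    (rs a rs' a' : seq nat) : Prop :=
  reach p n b T (R * E) (Config k rs a) (Config k' rs' a').

Lemma tame_operand_lt f rs x : e <= f ->
  tame_operand x -> small R f rs -> operand_eval n b rs x < 2 ^ f.
Proof.
move=> le_f; have le_ef : 2 ^ e <= 2 ^ f by rewrite leq_exp2l.
case: x => //= [r _ | c le_c | _] rs_small; first exact: small_nth rs_small.
  by apply: leq_trans le_ef; apply: leq_ltn_trans le_c _; rewrite (@ltn_exp2l 2 3).
exact: leq_trans le_ef.
Qed.

Lemma binop_small f rs o d x y : e <= f ->
  tame_instr R (Op o d x y) -> small R f rs ->
  small R (grow (Op o d x y) f)
    (set_nth 0 rs d (binop_eval o (operand_eval n b rs x) (operand_eval n b rs y))).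
Proof.
move=> le_f tame rs_small.
have le_g := small_widen (leq_grow (Op o d x y) f) rs_small.
have xP := @tame_operand_lt f rs x le_f; have yP := @tame_operand_lt f rs y le_f.
case: o tame le_g => //= /andP[lt_d tame] le_g; apply: small_set => //.
- case/andP: tame => /xP/(_ rs_small) ? /yP/(_ rs_small) ?.
  by rewrite expnS mul2n -addnn; lia.
- by have := xP tame rs_small; lia.
- case/andP: tame => /xP/(_ rs_small) ? /yP/(_ rs_small) ?.
  by rewrite expnD ltn_mul.
- by apply: leq_ltn_trans (xP tame rs_small); apply: leq_div.
- by apply: leq_ltn_trans (xP tame rs_small); apply: leq_mod.
Qed.

Lemma wp_reach f p k l (Q : seq nat -> seq nat -> Prop) rs a :
    all (tame_instr R) l -> code_at p k l ->
    e <= f -> grow_block l f <= E -> small R f rs -> wp n b w l Q rs a ->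
  exists rs' a', Q rs' a' /\
    config_reach (size l) p k (k + size l) rs a rs' a'.
Proof.
rewrite /config_reach.
elim: l f k rs a => [|i l IHl] f k rs a /=.
  move=> _ _ le_f le_E rs_small Qrs; exists rs, a; split=> //.
  by rewrite addn0; apply/reach_refl/small_space/(small_widen le_E).
move=> /andP[tame_i tame_l] /code_at_cons[pk code] le_f le_E rs_small wpl.
suff [rs' [a' [st rs'_small {}wpl]]] : exists rs' a',
    [/\ step p n b (Config k rs a) = Some (Config k.+1 rs' a'),
      small R (grow i f) rs' & wp n b w l Q rs' a'].
  have le_gE : grow i f <= E by apply: leq_trans le_E; apply: leq_grow_block.
  have le_fE := leq_trans (leq_grow i f) le_gE.
  have [] := IHl _ _ _ _ tame_l code _ le_E rs'_small wpl.
    exact: leq_trans (leq_grow i f).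
  move=> rs2 [a2 [Q2 re2]]; exists rs2, a2; split=> //.
  rewrite addnS -addSn -add1n; apply: reach_trans re2.
  apply: reach_step st _ _; apply: small_space; first exact: small_widen rs_small.
  exact: small_widen rs'_small.
move: wpl; rewrite /= pk {pk code}; case: i tame_i {le_E} => //.
- move=> o d x y tame /(_ _ erefl) wpl.
  by do 2 eexists; split; [reflexivity| exact: binop_small|].
- move=> d i base disp len lt_d [lt_i le_b le_w] /(_ _ erefl) wpl.
  rewrite lt_i le_b; do 2 eexists; split; [reflexivity| |exact: wpl].
  apply: small_set => //; apply: leq_trans (_ : 2 ^ operand_eval n b rs len <= _).
    by rewrite ltn_pmod ?expn_gt0.
  by rewrite leq_exp2l //=; apply: leq_trans le_w (leq_trans w_le le_f).
- move=> i base disp len x _ [lt_i le_b] /(_ _ erefl) wpl.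
  by rewrite lt_i le_b; do 2 eexists; split; [reflexivity| |exact: wpl].
Qed.

Definition triple (ss : seq seg) (P Q : seq nat -> seq nat -> Prop) (T : nat) :=
  forall p k rs a, code_at p k (segs_code k ss) -> P rs a ->
  exists rs' a', Q rs' a' /\
    config_reach T p k (k + size (segs_code k ss)) rs a rs' a'.

Lemma triple_cat ss1 ss2 (P M Q : seq nat -> seq nat -> Prop) T1 T2 :
  triple ss1 P M T1 -> triple ss2 M Q T2 -> triple (ss1 ++ ss2) P Q (T1 + T2).
Proof.
move=> t1 t2 p k rs a; rewrite segs_code_cat => /code_at_cat[code1 code2] Prs.
have [rs1 [a1 [M1 re1]]] := t1 _ _ _ _ code1 Prs.
have [rs2 [a2 [Q2 re2]]] := t2 _ _ _ _ code2 M1.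
exists rs2, a2; split=> //; apply: reach_trans re1 _.
by rewrite size_cat addnA.
Qed.

Lemma triple_cons s ss (P M Q : seq nat -> seq nat -> Prop) T1 T2 :
  triple [:: s] P M T1 -> triple ss M Q T2 -> triple (s :: ss) P Q (T1 + T2).
Proof. exact: triple_cat. Qed.

(** Turns the state reached at some point into a fixed parameter, to which later assertions can
    refer. *)
Lemma triple_pointwise ss (P Q : seq nat -> seq nat -> Prop) T :
  (forall rs0 a0, P rs0 a0 -> triple ss (fun rs a => rs = rs0 /\ a = a0) Q T) ->
  triple ss P Q T.
Proof. by move=> tss p k rs a code /tss; apply. Qed.

Lemma triple_sub ss (P P' Q Q' : seq nat -> seq nat -> Prop) T T' :
  (forall rs a, P' rs a -> P rs a) -> (forall rs a, Q rs a -> Q' rs a) ->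
  T <= T' -> triple ss P Q T -> triple ss P' Q' T'.
Proof.
move=> subP subQ le_T tss p k rs a code /subP Prs.
have [rs1 [a1 [/subQ Q1 re1]]] := tss _ _ _ _ code Prs.
by exists rs1, a1; split=> //; apply: reach_le re1.
Qed.

Lemma triple_block l (P Q : seq nat -> seq nat -> Prop) :
    all (tame_instr R) l -> grow_block l e <= E ->
    (forall rs a, P rs a -> small R e rs /\ wp n b w l Q rs a) ->
  triple [:: Blk l] P Q (size l).
Proof.
move=> tame le_E wpl p k rs a; rewrite /= cats0 => code /wpl[rs_small {}wpl].
exact: wp_reach tame code (leqnn e) le_E rs_small wpl.
Qed.

(** An iteration costs the body, the test and the jump back; the final 2 pays for the failing test
    and the exit jump. *)
Lemma triple_loop x y l K (I : nat -> seq nat -> seq nat -> Prop) :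
    all (tame_instr R) l -> grow_block l e <= E ->
    (forall k rs a, k <= K -> I k rs a -> small R e rs) ->
    (forall k rs a, k < K -> I k rs a ->
       operand_eval n b rs x < operand_eval n b rs y /\ wp n b w l (I k.+1) rs a) ->
    (forall rs a, I K rs a -> operand_eval n b rs y <= operand_eval n b rs x) ->
  triple [:: Loop x y l] (I 0) (I K) (K * (size l + 2) + 2).
Proof.
move=> tame le_E I_small I_body I_end p k rs a; rewrite /= cats0 => code I0.
have [pk0 /code_at_cons[pk1 code']] := code_at_cons code.
have [codel /code_at_cons[pk2 _]] := code_at_cat code'.
have le_eE := leq_trans (leq_grow_block l e) le_E.
have sp k' rs' a' : small R e rs' -> space (Config k' rs' a') <= R * E.
  by move=> rs_small; apply/small_space/(small_widen le_eE).
suff iterl j : j <= K -> exists rs' a', I j rs' a' /\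
    config_reach (j * (size l + 2)) p k k rs a rs' a'.
  have [rs' [a' [IK re]]] := iterl K (leqnn K).
  exists rs', a'; split=> //; apply: reach_trans re _.
  have rs'_small := I_small _ _ _ (leqnn K) IK.
  apply: (@reach_trans _ _ _ 1 1 _ _ (Config k.+1 rs' a'));
    apply: reach_step; rewrite ?sp // /step.
    by rewrite pk0 ltnNge (I_end _ _ IK).
  by rewrite pk1; congr (Some (Config _ _ _)); rewrite size_cat /=; lia.
elim: j => [_|j IHj lt_j].
  by exists rs, a; split=> //; apply/reach_refl/sp; apply: I_small I0.
have [rs1 [a1 [Ij re1]]] := IHj (ltnW lt_j).
have rs1_small := I_small _ _ _ (ltnW lt_j) Ij.
have [lt_xy wpl] := I_body _ _ _ lt_j Ij.
have [rs2 [a2 [Ij1 re2]]] := wp_reach tame codel (leqnn e) le_E rs1_small wpl.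
exists rs2, a2; split=> //.
have rs2_small := I_small _ _ _ lt_j Ij1.
rewrite mulSn addnC; apply: reach_trans re1 _.
rewrite addn2 -addn1 -add1n.
apply: (@reach_trans _ _ _ (1 + size l) 1 _ _ (Config (k.+2 + size l) rs2 a2)).
  apply: reach_trans re2; apply: reach_step; rewrite ?sp // /step.
  by rewrite pk0 lt_xy addn2.
by apply: reach_step; rewrite ?sp // /step pk2.
Qed.

End Triples.

(** For [n <= 4] no bit has to be freed and the identity will do. From [n = 5] on, [lg_ceil n >= 3],
    so there is a leading three-bit digit to strip. *)
Definition guarded_program (ss : seq seg) : program :=
  Jlt ArrayLen (Imm 5) (size (segs_code 1 ss)).+1 :: segs_code 1 ss.

Lemma guarded_program_small ss n b T S a :
  n < 5 -> 0 < T -> transforms_within (guarded_program ss) n b T S a a.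
Proof.
move=> lt_n T_gt0; have run1 : run (guarded_program ss) n b a 1 =
    Some (Config (size (segs_code 1 ss)).+1 [::] a) by rewrite /run /= lt_n.
exists 1; split=> //; first by eexists; split; [exact: run1 | rewrite /halted /=|].
move=> [|[|j]] c // _; last by rewrite run1 => -[<-]; rewrite /space big_nil.
by case=> <-; rewrite /space big_nil.
Qed.

Lemma guarded_program_big ss n b R E T a (Q : seq nat -> Prop) :
    4 < n ->
    triple n b R E ss (fun rs a' => rs = [::] /\ a' = a) (fun _ => Q) T ->
  exists a', Q a' /\ transforms_within (guarded_program ss) n b T.+1 (R * E) a a'.
Proof.
move=> lt_n tss; have [] := tss (guarded_program ss) 1 [::] a _ (conj erefl erefl).
  by move=> j lt_j; rewrite add1n.
move=> rs [a' [Qa']]; rewrite /config_reach => re; exists a'; split=> //.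
have : reach (guarded_program ss) n b 1 (R * E) (Config 0 [::] a) (Config 1 [::] a).
  by apply: reach_step; rewrite /space ?big_nil //= ifN //; lia.
move=> /reach_trans/(_ re)[k [le_k it sp]]; exists k; split=> //.
by eexists; split; [exact: it | rewrite /halted /= add1n |].
Qed.

(** Halted configurations are fixed by the iterated map, so any [T] from the halting time on yields
    the final array. The compact form is thus a function obtained by computation, without choice. *)
Definition final_cells (p : program) (n b T : nat) (a : seq nat) : seq nat :=
  cells (iter T (fun c => odflt c (step p n b c)) (Config 0 [::] a)).

Lemma final_cellsE p n b T S a a' :
  transforms_within p n b T S a a' -> final_cells p n b T a = a'.
Proof.
case=> k [le_k [c [run_k halt_c <-]] _]; rewrite /final_cells; congr cells.
have stepN c' : halted p c' -> step p n b c' = None.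
  by case: c' => k' rs a'' /= halt; rewrite onth_default.
have it j c' d : iter j (obind (step p n b)) (Some d) = Some c' ->
    iter j (fun c => odflt c (step p n b c)) d = c'.
  elim: j c' => [|j IHj] c' /=; first by case.
  case: (iter j (obind _) _) (IHj) => //= d' /(_ _ erefl) ->.
  by move=> ->.
rewrite -(subnK le_k) iterD (it _ _ _ run_k).
by elim: (T - k) => //= j ->; rewrite stepN.
Qed.

(** * The programs *)

Local Notation rT := 0 (only parsing).
Local Notation rN := 1 (only parsing).
Local Notation rM := 2 (only parsing).
Local Notation rQ := 3 (only parsing).
Local Notation rI := 4 (only parsing).
Local Notation rK := 5 (only parsing).
Local Notation rB := 6 (only parsing).
Local Notation rU := 13 (only parsing).
Local Notation rV := 14 (only parsing).
Local Notation rW := 15 (only parsing).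
Local Notation rX := 16 (only parsing).
Local Notation rY := 17 (only parsing).
Local Notation rDst := 18 (only parsing).
Local Notation rHole := 19 (only parsing).
Local Notation rSrc := 20 (only parsing).
Local Notation rDepth := 21 (only parsing).
Local Notation nregs := 22 (only parsing).
(* [Sub] alone is the subtype constructor of [eqtype]. *)
Local Notation sub := Defs.Sub (only parsing).

Definition clear (r : nat) : instr := Op sub r (Imm 0) (Imm 0).

Definition prelude : seq seg :=
  [:: Blk [:: Op Add rN (Imm 1) (Imm 0); clear rDepth];
      Loop (Reg rN) ArrayLen
        [:: Op Add rN (Reg rN) (Reg rN); Op Add rT (Reg rT) (Imm 1)];
      Blk [:: Op Div rM (Reg rN) (Imm 8); Op sub rQ (Reg rN) ArrayLen]].

(* For [c <= 1], truncated subtraction makes [c - (v - j)] equal to [c] if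
   [v <= j] and to 0 otherwise. *)
Definition bump (j : nat) (c v : operand) : seq instr :=
  [:: Op sub rW v (Imm j); Op sub rW c (Reg rW);
      Op Add (rB + j) (Reg (rB + j)) (Reg rW)].

(** Counter [j] holds the number of cells whose leading digit is at most [j]; the digit of cell [i]
    is therefore the number of counters that do not exceed [i]. *)
Definition top_digit : seq instr :=
  clear rV :: flatten [seq
    [:: Op sub rW (Reg (rB + j)) (Reg rI); Op sub rW (Imm 1) (Reg rW);
        Op Add rV (Reg rV) (Reg rW)] | j <- iota 0 7].

Definition strip_body : seq instr :=
  [:: Read rU (Reg rI) CellBits (Reg rT) (Reg rT);
      Op Div rV (Reg rU) (Reg rM)] ++
  flatten [seq bump j (Imm 1) (Reg rV) | j <- iota 0 7] ++
  [:: Op Mod rU (Reg rU) (Reg rM); Op Mul rU (Reg rU) (Imm 8);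
      Write (Reg rI) CellBits (Reg rT) (Reg rT) (Reg rU);
      Op Add rI (Reg rI) (Imm 1); clear rU; clear rV; clear rW].

Definition mark_body : seq instr :=
  [:: Op sub rU (Reg rT) (Imm 3);
      Read rX (Reg rI) CellBits (Reg rU) (Reg rU)] ++
  top_digit ++
  [:: Op Mul rV (Reg rV) (Reg rM); Op Add rV (Reg rV) (Reg rX);
      Op Add rV (Reg rV) (Reg rI);
      Op Div rW (Reg rV) ArrayLen; Op Mod rV (Reg rV) ArrayLen;
      Write (Reg rI) CellBits (Reg rU) (Reg rU) (Imm 0);
      Op sub rW (Reg rT) (Reg rW);
      Write (Reg rV) CellBits (Reg rW) (Imm 1) (Imm 1);
      Op Add rI (Reg rI) (Imm 1); clear rU; clear rV; clear rW; clear rX].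

Definition hole_size_code (d c : nat) : seq instr :=
  [:: Op Add d (Reg c) (Imm 1); Op sub d (Reg d) (Reg rQ);
      Op sub d (Imm 1) (Reg d); Op sub d (Reg rY) (Reg d)].

Definition move_init : seq instr :=
  [:: Op sub rSrc ArrayLen (Imm 1); Op sub rY (Reg rT) (Imm 2)] ++
  hole_size_code rHole rDst ++ hole_size_code rDepth rSrc ++ [:: clear rY].

Definition copy_out : seq instr :=
  [:: Read rV (Reg rSrc) CellBits (Reg rDepth) (Reg rU);
      Write (Reg rDst) CellBits (Reg rHole) (Reg rU) (Reg rV);
      Write (Reg rSrc) CellBits (Reg rDepth) (Reg rU) (Imm 0)].

Definition copy_back : seq instr :=
  [:: Read rV (Reg rDst) CellBits (Reg rHole) (Reg rU);
      Write (Reg rSrc) CellBits (Reg rDepth) (Reg rU) (Reg rV)].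

(* [rU] receives the number of bits copied, the minimum of [hole] and
   [b - depth] computed without storing [b], which may not fit. *)
Definition move_body (copy : seq instr) : seq instr :=
  [:: Op Add rU (Reg rDepth) (Reg rHole); Op sub rU (Reg rU) CellBits;
      Op sub rU (Reg rHole) (Reg rU); Op Add rDepth (Reg rDepth) (Reg rU)] ++
  copy ++
  [:: Op sub rHole (Reg rHole) (Reg rU); Op sub rV (Imm 1) (Reg rHole);
      Op sub rW (Imm 1) (Reg rV); Op Add rDst (Reg rDst) (Reg rV);
      Op sub rSrc (Reg rSrc) (Reg rW); Op sub rY (Reg rT) (Imm 2)] ++
  hole_size_code rX rDst ++
  [:: Op Mul rX (Reg rX) (Reg rV); Op Add rHole (Reg rHole) (Reg rX)] ++
  hole_size_code rX rSrc ++
  [:: Op Mul rX (Reg rX) (Reg rW); Op Mul rDepth (Reg rDepth) (Reg rV);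
      Op Add rDepth (Reg rDepth) (Reg rX);
      clear rU; clear rV; clear rW; clear rX; clear rY].

Definition move_segs (copy : seq instr) : seq seg :=
  [:: Blk move_init; Loop (Reg rDst) (Reg rSrc) (move_body copy)].

(* The cell [dst] is being filled, its [hole] top bits being still free; the
   cell [src] is being emptied, its top [depth] bits being already free. *)
Record sched := Sched { dst : nat; hole : nat; src : nat; depth : nat }.

(** The write is made whether or not the bit read is a one: on a zero, neither the cell index nor
    the counters move, and a later iteration overwrites the cell. *)
Definition decode_body : seq instr :=
  [:: Op sub rU (Reg rT) (Imm 3);
      Op Div rV (Reg rK) ArrayLen; Op Mod rW (Reg rK) ArrayLen;
      Op sub rV (Reg rT) (Reg rV);
      Read rX (Reg rW) CellBits (Reg rV) (Imm 1);
      Op sub rY (Reg rK) (Reg rI);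
      Op Mod rV (Reg rY) (Reg rM);
      Write (Reg rI) CellBits (Reg rU) (Reg rU) (Reg rV);
      Op Div rV (Reg rY) (Reg rM)] ++
  flatten [seq bump j (Reg rX) (Reg rV) | j <- iota 0 7] ++
  [:: Op Add rI (Reg rI) (Reg rX); Op Add rK (Reg rK) (Imm 1);
      clear rU; clear rV; clear rW; clear rX; clear rY].

Definition restore_body : seq instr :=
  [:: Op sub rU (Reg rT) (Imm 3);
      Read rX (Reg rI) CellBits (Reg rU) (Reg rU)] ++
  top_digit ++
  [:: Op Mul rV (Reg rV) (Reg rM); Op Add rV (Reg rV) (Reg rX);
      Write (Reg rI) CellBits (Reg rT) (Reg rT) (Reg rV);
      Op Add rI (Reg rI) (Imm 1); clear rU; clear rV; clear rW; clear rX].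

Definition compress_segs : seq seg :=
  prelude ++
  [:: Loop (Reg rI) ArrayLen strip_body; Blk [:: clear rI];
      Loop (Reg rI) ArrayLen mark_body] ++
  move_segs copy_out.

Definition decompress_segs : seq seg :=
  prelude ++ move_segs copy_back ++
  [:: Blk [:: clear rDst; clear rHole; clear rSrc; clear rDepth];
      Loop (Reg rI) ArrayLen decode_body; Blk [:: clear rI; clear rK];
      Loop (Reg rI) ArrayLen restore_body].

(** * Correctness of the passes *)

Section Passes.

Variables (n b t : nat).
Hypotheses (n_gt4 : 4 < n) (tE : t = up_log 2 n) (le_tb : t <= b).

Local Notation e := (3 * t).
(** The largest growth is that of [move_body], whose three multiplications double the exponent three
    times: it reaches [24 * t + 41], at most [60 * t] as [t >= 3]. *)
Local Notation E := (60 * t).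
Local Notation triple := (triple n b nregs E).
Local Notation wp := (wp n b t).

Lemma n_le_pow : n <= 2 ^ t. Proof. by rewrite tE up_logP. Qed.

Lemma pow_lt_2n : 2 ^ t < n.*2.
Proof.
have : 2 ^ t.-1 < n by rewrite tE up_log_gtn //; lia.
have t_gt0 : 0 < t by rewrite tE up_log_gt0; lia.
have -> : 2 ^ t = 2 * 2 ^ t.-1 by rewrite -expnS prednK.
by lia.
Qed.

Lemma t_ge3 : 3 <= t.
Proof. by rewrite -(@ltn_exp2l 2 2) //; apply: leq_trans n_gt4 n_le_pow. Qed.

Lemma pow3 : 2 ^ t = 8 * 2 ^ (t - 3).
Proof. by rewrite -(@expnD 2 3) subnKC // t_ge3. Qed.

Lemma t_lt_pow : t < 2 ^ t. Proof. exact: ltn_expl. Qed.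

Lemma pow_bound : 64 * 2 ^ t <= 2 ^ e.
Proof.
have -> : e = t + t + t by lia.
have := n_le_pow; rewrite !expnD; set N := 2 ^ t => le_n.
have ? : 8 <= N by rewrite /N (@leq_exp2l 2 3) // t_ge3.
nia.
Qed.

Lemma pow_bound2 : 4 * (2 ^ t * 2 ^ t) <= 2 ^ e.
Proof.
have -> : e = t + t + t by lia.
rewrite !expnD; set N := 2 ^ t.
have ? : 8 <= N by rewrite /N (@leq_exp2l 2 3) // t_ge3.
nia.
Qed.

Lemma e_gt3 : 3 < e. Proof. by have := t_ge3; lia. Qed.
Lemma n_lt_e : n < 2 ^ e.
Proof. by have := n_le_pow; have := pow_bound; lia. Qed.
Lemma w_le : t <= e. Proof. by lia. Qed.

Let t3 : 3 <= t := t_ge3.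
Let triple_loop := @triple_loop n b t nregs e E e_gt3 n_lt_e w_le.
Let triple_block := @triple_block n b t nregs e E e_gt3 n_lt_e w_le.

(** The five zeros are the scratch registers, zero again after every iteration, so that only the
    other values have to be tracked. *)
Definition mkregs (i k : nat) (B : nat -> nat) (dst hole src depth : nat) : seq nat :=
  [:: t; 2 ^ t; 2 ^ (t - 3); 2 ^ t - n; i; k;
      B 0; B 1; B 2; B 3; B 4; B 5; B 6; 0; 0; 0; 0; 0; dst; hole; src; depth].

Lemma mkregs_small i k B dst hole src depth :
    i <= 4 * n -> k <= 4 * n -> (forall j, B j <= n) ->
    dst <= n -> hole <= t -> src <= n -> depth <= t * n.+2 ->
  small nregs e (mkregs i k B dst hole src depth).
Proof.
move=> lei lek leB led leh les ledp.
have := n_le_pow; have := pow_bound; have := pow_bound2; have := t_lt_pow.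
have := pow_lt_2n; have := pow3 => E3 ? ? ? ? ?.
(* Only [depth] is bounded by a product, whence the quadratic bound [pow_bound2]. *)
have ? : depth < 2 ^ e by set N := 2 ^ t in E3 * ; nia.
have ltB j : B j < 2 ^ e by have := leB j; lia.
rewrite /small /= !ltB /=.
by repeat (apply/andP; split); lia.
Qed.

Lemma prelude_triple (a : seq nat) :
  triple prelude (fun rs a' => rs = [::] /\ a' = a)
    (fun rs a' => rs = mkregs 0 0 (fun=> 0) 0 0 0 0 /\ a' = a) (7 * n).
Proof.
have t_le : t <= n.
  by rewrite tE; apply: up_log_min => //; apply: ltnW; apply: ltn_expl.
(* Clearing the last register has extended the register list to its full length 22. *)
pose I j (rs a' : seq nat) := rs = j :: 2 ^ j :: nseq 20 0 /\ a' = a.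
have Ismall j rs a' : j <= t -> I j rs a' -> small nregs e rs.
  move=> le_j [-> _]; rewrite /small /= !expn_gt0 /=.
  have : 2 ^ j <= 2 ^ t by rewrite leq_exp2l.
  by have := pow_bound; have := t_lt_pow; lia.
apply: (@triple_sub _ _ _ _ _ (fun rs a' => rs = [::] /\ a' = a) _
   (fun rs a' => rs = mkregs 0 0 (fun=> 0) 0 0 0 0 /\ a' = a) _
   (2 + ((t * 4 + 2) + 2))) => //; first by lia.
apply: (triple_cons (M := I 0)).
  apply: triple_block => //=; first by have := t_ge3; lia.
  move=> rs a' [-> ->]; split; first by [].
  by move=> v1 -> v2 ->.
apply: (triple_cons (M := I t)).
  apply: triple_loop => //=; first by have := t_ge3; lia.
    move=> k rs a' lt_k [-> ->] /=; split.
      rewrite ltnNge; apply/negP => /(@up_log_min 2 n k erefl); rewrite -tE; lia.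
    move=> v1 -> v2 ->; split=> //=.
    by rewrite addn1 addnn -mul2n -expnS.
  by move=> rs a' [-> _] /=; apply: n_le_pow.
apply: triple_block => //=; first by have := t_ge3; lia.
move=> rs a' It; split; first exact: Ismall It.
case: It => -> -> /= v1 -> v2 ->; split=> //.
by rewrite /mkregs pow3 mulKn.
Qed.

(** * Sizes of the holes and schedule of the copies *)

Definition hole_size (c : nat) : nat := t - 2 - (1 - (c + 1 - (2 ^ t - n))).

(** Planes 0 and 1 use every cell; plane 2 is needed only in the cells below [2 ^ t - n], because
    the positions to be marked are below [n + 2 ^ t - 1]. *)
Lemma hole_sizeE c : hole_size c = t - 2 - (c < 2 ^ t - n).
Proof. by rewrite /hole_size; lia. Qed.

Lemma hole_size_le c : hole_size c <= t - 2.
Proof. by rewrite /hole_size; lia. Qed.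

Lemma sum_hole_size : \sum_(0 <= c < n) hole_size c = n * t - n - 2 ^ t.
Proof.
have lt_2n := pow_lt_2n; have le_n := n_le_pow.
set q := 2 ^ t - n; have le_q : q <= n by rewrite /q; lia.
rewrite (big_cat_nat (leq0n q) le_q) /=.
rewrite (eq_big_nat _ _ (F2 := fun=> t - 3)); last first.
  by move=> c lt_c; rewrite hole_sizeE -/q; lia.
rewrite [X in _ + X](eq_big_nat _ _ (F2 := fun=> t - 2)); last first.
  by move=> c lt_c; rewrite hole_sizeE -/q; lia.
rewrite !sum_nat_const_nat /q; nia.
Qed.

Definition chunk (m : sched) : nat := hole m - (depth m + hole m - b).

(** Here [z] is 1 if the hole has been completed and 0 otherwise: as in [move_body], multiplying by
    [z] and [1 - z] replaces a branch. *)
Definition sched_next (m : sched) : sched :=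
  let h := hole m - chunk m in
  let z := 1 - h in
  let d := dst m + z in
  let s := src m - (1 - z) in
  Sched d (h + hole_size d * z) s
    ((depth m + chunk m) * z + hole_size s * (1 - z)).

Definition sched_at (k : nat) : sched :=
  iter k sched_next (Sched 0 (hole_size 0) (n - 1) (hole_size (n - 1))).

(** A chunk that completes the hole and empties the source at once counts as completing the hole;
    the source, now at depth [b], can be left only by a later, empty chunk. *)
Lemma sched_nextP m : depth m <= b ->
  let m' := sched_next m in
  [/\ chunk m = hole m, dst m' = (dst m).+1, hole m' = hole_size (dst m).+1,
      src m' = src m & depth m' = depth m + chunk m] \/
  [/\ chunk m < hole m, chunk m = b - depth m &
      [/\ dst m' = dst m, hole m' = hole m - chunk m,
      src m' = src m - 1 & depth m' = hole_size (src m - 1)]].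
Proof.
case: m => d h s dp /= le_dp; set u := chunk _.
have uE : u = h - (dp + h - b) by [].
rewrite /= -/u; case: (posnP (h - u)) => [h0 | h_gt0].
  left; rewrite h0 /= !subn0 subnn muln0 !muln1 add0n !addn0 addn1; split=> //; lia.
right; have -> : 1 - (h - u) = 0 by lia.
rewrite !muln0 !addn0 muln1; split=> //; lia.
Qed.

(** Each step moves [dst] or [src] by one, so they meet after [n - 1] steps. The bound
    [t * (dst m + 2)] lets [depth] fit in a register even when [b] does not. The disjunction says
    that the hole or the source cell is fresh; when the two cells coincide, the free bits therefore
    form a single block. The sum says that copying preserves the number of free bits. *)
Definition sched_ok (k : nat) (m : sched) : Prop :=
  [/\ dst m + (n - 1) = k + src m, src m < n, dst m <= src m,
    hole m <= hole_size (dst m) &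
    [/\ hole_size (src m) <= depth m, depth m <= b,
      depth m + hole m <= t * (dst m + 2),
      hole m = hole_size (dst m) \/ depth m = hole_size (src m) &
      \sum_(0 <= c < (dst m).+1) hole_size c + \sum_(src m <= c < n) hole_size c =
      hole m + depth m + (n - 1 - src m) * b]].

Lemma sched_at_ok k : k < n -> sched_ok k (sched_at k).
Proof.
elim: k => [|k IHk] lt_k.
  have := hole_size_le 0; have := hole_size_le (n - 1) => ? ?.
  split=> /=; [lia|lia|lia|lia|split; [lia|lia|lia|by left|]].
  rewrite big_nat1 (@big_ltn _ _ _ (n - 1)); last by lia.
  by rewrite big_geq; lia.
have [] := IHk (ltnW lt_k); rewrite {IHk} [sched_at k.+1]/=.
move: (sched_at k) => m dstE lt_src le_dst le_hole [le_depth depth_b le_sum full bal].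
have lt_dst : dst m < src m by lia.
have := sched_nextP depth_b; move: (sched_next m) => m' /= [].
  case=> uE dE hE sE dpE; rewrite /sched_ok dE hE sE dpE uE.
  have := hole_size_le (dst m).+1 => ?.
  split; [lia|lia|lia|lia|split; [lia| |lia|by left|]].
    by move: uE; rewrite /chunk; lia.
  by rewrite big_nat_recr //=; lia.
case=> u_lt uE [dE hE sE dpE]; rewrite /sched_ok dE hE sE dpE uE.
have := hole_size_le (src m - 1) => ?.
split; [lia|lia|lia|lia|split; [lia|lia|nia|by right|]].
rewrite (@big_ltn _ _ _ (src m - 1)); last by lia.
rewrite (_ : (src m - 1).+1 = src m); last by lia.
have -> : n - 1 - (src m - 1) = (n - 1 - src m).+1 by lia.
by rewrite mulSn; lia.
Qed.

(** * Gathering the holes at the end of the array, and the way back *)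

Section Moves.

Variable a1 : seq nat.

Definition src_pos (m : sched) (c s : nat) : bool :=
  (c < src m) || (c == src m) && (s < b - depth m).

Definition dst_pos (m : sched) (c s : nat) : bool :=
  (c < dst m) || (c == dst m) && (s < b - hole m).

Definition moved_by (a : seq nat) (m : sched) : Prop :=
  forall u, u < chunk m -> cell_bit a (dst m) (b - hole m + u) =
    cell_bit a1 (src m) (b - (depth m + chunk m) + u).

(** Each chunk is recorded by its step of the schedule, so that decompression finds it at the same
    step without a closed formula for its place. *)
Definition moved_out (a : seq nat) : Prop :=
  let m := sched_at (n - 1) in
  [/\ is_array n b a,
    forall c s, c < n -> s < b - hole_size c ->
      cell_bit a c s = src_pos m c s && cell_bit a1 c s,
    forall c s, c < n -> s < b -> b - hole_size c <= s -> ~~ dst_pos m c s ->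
      cell_bit a c s = false &
    forall j, j < n - 1 -> moved_by a (sched_at j)].

(** The free bits form the tail of the array, namely the top of the meeting cell and all later
    cells, and their number is the total size of the holes. *)
Lemma moved_out_zero a : moved_out a ->
  last_bits_zero n b (\sum_(0 <= c < n) hole_size c) a.
Proof.
move=> [a_arr a_data a_hole _].
have b_gt0 : 0 < b by lia.
have [|dstE lt_src le_dst le_hole] := @sched_at_ok (n - 1); first by lia.
case=> le_depth depth_b _ full bal.
move: (sched_at (n - 1)) a_data a_hole dstE lt_src le_dst le_hole le_depth depth_b full bal.
move=> m a_data a_hole dstE lt_src le_dst le_hole le_depth depth_b full bal.
have {le_dst} dstE' : dst m = src m by lia.
(* Both sums of the balance now contain the meeting cell, hence the extra term. *)
have {bal} bal : \sum_(0 <= c < n) hole_size c + hole_size (src m) =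
    hole m + depth m + (n - 1 - src m) * b.
  rewrite -bal dstE' (@big_cat_nat _ _ _ (src m).+1 0 n) //=.
  by rewrite (@big_ltn _ _ _ (src m) n) //; lia.
move=> q /andP[q_ge q_lt].
have lt_c : q %/ b < n by rewrite ltn_divLR.
have lt_s : q %% b < b by rewrite ltn_mod.
rewrite /array_bit -/(bit _ _) -/(cell_bit _ _ _).
have {q_ge q_lt} : n * b <= q %/ b * b + q %% b + \sum_(0 <= c < n) hole_size c.
  by rewrite -divn_eq; lia.
move: (q %/ b) (q %% b) lt_c lt_s => c s lt_c lt_s {q} q_ge.
(* By [full], one of [hole m] and [depth m] equals [hole_size (src m)]; the difference is the other
   one, which is the size of the free top of the meeting cell. *)
have ge_src : (src m < c) || (c == src m) && (b <= s + (hole m + depth m - hole_size (src m))).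
  case: (ltngtP c (src m)) => [lt_cs | // | cE] /=.
    have : hole m + depth m <= b + hole_size (src m) by move: full le_hole; rewrite dstE'; lia.
    nia.
  by subst c; nia.
have [lt_hole | ge_hole] := ltnP s (b - hole_size c).
  rewrite a_data // (_ : src_pos _ _ _ = false) // /src_pos.
  move: lt_hole ge_src full le_hole; rewrite dstE'.
  by case: (eqVneq c (src m)) => [-> | ?]; lia.
apply: a_hole => //; rewrite /dst_pos dstE'.
move: ge_hole ge_src full le_hole; rewrite dstE'.
by case: (eqVneq c (src m)) => [-> | ?]; lia.
Qed.

Variables (i : nat) (B : nat -> nat).
Hypotheses (i_le : i <= 4 * n) (B_le : forall j, B j <= n).

Definition sched_regs (m : sched) : seq nat :=
  mkregs i 0 B (dst m) (hole m) (src m) (depth m).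

Lemma sched_regs_small k : k < n -> small nregs e (sched_regs (sched_at k)).
Proof.
move=> /sched_at_ok[? ? ? ? [? ? ? _ _]].
have := hole_size_le (dst (sched_at k)) => ?.
apply: mkregs_small => //; try lia; nia.
Qed.

Lemma move_init_triple (a : seq nat) :
  triple [:: Blk move_init] (fun rs a' => rs = mkregs i 0 B 0 0 0 0 /\ a' = a)
    (fun rs a' => rs = sched_regs (sched_at 0) /\ a' = a) 11.
Proof.
apply: triple_block => //=; first by lia.
move=> rs a' [-> ->]; split; first by apply: mkregs_small => //; lia.
by move=> /=; do 11 (move=> ? ->).
Qed.

Hypothesis a1_arr : is_array n b a1.
Hypothesis a1_hole : forall c s,
  c < n -> s < b -> b - hole_size c <= s -> cell_bit a1 c s = false.

(** The clause on [dst_pos] places the chunks already copied behind the filling front, out of reach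
    of later writes. *)
Definition out_inv (k : nat) (rs a : seq nat) : Prop :=
  let m := sched_at k in
  [/\ rs = sched_regs m, is_array n b a,
    forall c s, c < n -> s < b - hole_size c ->
      cell_bit a c s = src_pos m c s && cell_bit a1 c s,
    forall c s, c < n -> s < b -> b - hole_size c <= s -> ~~ dst_pos m c s ->
      cell_bit a c s = false &
    forall j, j < k -> moved_by a (sched_at j) /\ forall u, u < chunk (sched_at j) ->
      dst_pos m (dst (sched_at j)) (b - hole (sched_at j) + u)].

Lemma out_triple :
  triple [:: Loop (Reg rDst) (Reg rSrc) (move_body copy_out)]
    (out_inv 0) (out_inv (n - 1)) (40 * n).
Proof.
apply: triple_sub (triple_loop (K := n - 1) (I := out_inv) _ _ _ _ _) => //=.
- by lia.
- by lia.
- by move=> k rs a le_k [-> _ _ _ _]; apply: sched_regs_small; lia.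
- move=> k rs a lt_k [-> a_arr a_data a_hole a_moved].
  have [] := @sched_at_ok k; first by lia.
  set m := sched_at k in a_data a_hole a_moved *.
  move=> dstE lt_src le_dst le_hole [le_depth depth_b le_sum full _].
  have lt_dst : dst m < src m by lia.
  split=> //=; do 4 (move=> ? ->); rewrite -/(chunk m).
  have uE : chunk m = hole m - (depth m + hole m - b) by [].
  have := hole_size_le (dst m); have := hole_size_le (src m) => gs gd.
  split=> //; [lia|lia|move=> v vE].
  split=> //; [lia|lia|move=> a2 a2E].
  split=> //; [lia|move=> a3 a3E].
  do 24 (move=> ? ->).
  have a2_arr : is_array n b a2 by rewrite a2E; apply: is_array_write => //; lia.
  have a3_bits c s : cell_bit a3 c s =
      if [&& c == src m, b - (depth m + chunk m) <= s & s < b - depth m] then false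
      else if [&& c == dst m, b - hole m <= s & s < b - hole m + chunk m]
      then cell_bit a1 (src m) (b - (depth m + chunk m) + (s - (b - hole m)))
      else cell_bit a c s.
    rewrite a3E cell_bit_write bit0 (_ : b - _ + chunk m = b - depth m); last by lia.
    case: ifP => // _; rewrite a2E cell_bit_write; case: and3P => // -[_ le_s s_lt].
    (* The chunk comes from positions not yet emptied, where the array still agrees with [a1]. *)
    rewrite vE bit_get -/(cell_bit a _ _) a_data //; [|lia].
    have -> : s - (b - hole m) < chunk m by lia.
    by have -> : src_pos m (src m) (b - (depth m + chunk m) + (s - (b - hole m)));
      rewrite // /src_pos; lia.
  have nextP := sched_nextP depth_b; rewrite /out_inv [sched_at k.+1]/= -/m.
  have dst_mono c s : dst_pos m c s -> dst_pos (sched_next m) c s.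
    by rewrite /dst_pos; case: nextP => [[_ -> _ _ _]|[_ _ [-> -> _ _]]]; lia.
  split.
  + by [].
  + by rewrite a3E; apply: is_array_write => //; lia.
  + move=> c s lt_c lt_s; rewrite a3_bits; case: and3P => [[/eqP cE le_s s_lt]|Nsrc].
      apply/esym/negbTE; rewrite negb_and /src_pos cE; apply/orP; left.
      by case: nextP => [[_ _ _ -> ->]|[_ ? [_ _ -> ->]]]; lia.
    case: and3P => [[/eqP cE le_s s_lt]|_]; first by move: lt_s; rewrite cE; lia.
    rewrite a_data //; congr (_ && _); rewrite /src_pos.
    case: (eqVneq c (src m)) => [cE | ne_c].
      have {}Nsrc : ~~ ((b - (depth m + chunk m) <= s) && (s < b - depth m)).
        by apply/negP => /andP[? ?]; apply: Nsrc; rewrite cE eqxx.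
      by case: nextP => [[_ _ _ -> ->]|[_ ? [_ _ -> ->]]]; lia.
    case: nextP => [[_ _ _ -> ->]|[_ ? [_ _ -> ->]]]; first by lia.
    by case: (eqVneq c (src m - 1)) lt_s => [-> | ?] ?; lia.
  + move=> c s lt_c lt_s le_s Ndst; rewrite a3_bits; case: ifP => // _.
    case: and3P => [[/eqP cE s_ge s_lt]|_].
      case/negP: Ndst; rewrite /dst_pos cE.
      by case: nextP => [[_ -> _ _ _]|[_ _ [-> -> _ _]]]; lia.
    by apply: a_hole => //; apply: contra Ndst; apply: dst_mono.
  move=> j; rewrite ltnS leq_eqVlt => /predU1P[-> | lt_j].
    rewrite -/m; split=> u lt_u.
      rewrite a3_bits; case: and3P => [[]|_]; first by lia.
      by case: and3P => [_|[]]; [congr cell_bit | split]; lia.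
    by rewrite /dst_pos; case: nextP => [[_ -> _ _ _]|[_ _ [-> -> _ _]]]; lia.
  have [mv pos] := a_moved j lt_j; split=> u lt_u; last by apply/dst_mono/pos.
  rewrite a3_bits -mv //; have := pos u lt_u; rewrite /dst_pos => ?.
  case: and3P => [[/eqP]|_]; first by lia.
  by case: and3P => [[/eqP]|//]; lia.
- move=> rs a [-> _ _ _ _] /=.
  have [] := @sched_at_ok (n - 1); lia.
Qed.

Lemma move_out_triple :
  triple (move_segs copy_out)
    (fun rs a => rs = mkregs i 0 B 0 0 0 0 /\ a = a1)
    (fun _ a => moved_out a) (51 * n).
Proof.
suff loop_triple : triple [:: Loop (Reg rDst) (Reg rSrc) (move_body copy_out)]
    (fun rs a => rs = sched_regs (sched_at 0) /\ a = a1) (fun _ a => moved_out a) (40 * n).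
  have := triple_cons (@move_init_triple a1) loop_triple.
  by apply: triple_sub => //; lia.
apply: triple_sub out_triple => //.
- move=> _ _ [-> ->]; split=> //.
  + move=> c s lt_c lt_s; rewrite (_ : src_pos _ _ _) // /src_pos /=.
    by case: (eqVneq c (n - 1)) lt_s => [-> | ?] ?; lia.
  + by move=> c s lt_c lt_s le_s _; apply: a1_hole.
- move=> rs a [_ a_arr a_data a_hole a_moved]; split=> //.
  by move=> j /a_moved[].
Qed.

Variable a2 : seq nat.
Hypothesis a2_out : moved_out a2.

(** Nothing is claimed about the holes: [copy_back] leaves stale bits there, which the decoder never
    reads. *)
Definition back_inv (k : nat) (rs a : seq nat) : Prop :=
  let m := sched_at k in
  [/\ rs = sched_regs m, is_array n b a,
    forall c s, src_pos m c s -> cell_bit a c s = cell_bit a2 c s &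
    forall c s, c < n -> s < b - hole_size c -> ~~ src_pos m c s ->
      cell_bit a c s = cell_bit a1 c s].

Lemma back_triple :
  triple [:: Loop (Reg rDst) (Reg rSrc) (move_body copy_back)]
    (back_inv 0) (back_inv (n - 1)) (40 * n).
Proof.
have [_ _ _ a2_moved] := a2_out.
apply: triple_sub (triple_loop (K := n - 1) (I := back_inv) _ _ _ _ _) => //=.
- by lia.
- by lia.
- by move=> k rs a le_k [-> _ _ _]; apply: sched_regs_small; lia.
- move=> k rs a lt_k [-> a_arr a_rest a_data].
  have [] := @sched_at_ok k; first by lia.
  have {a2_moved} := a2_moved k lt_k.
  set m := sched_at k in a_data a_rest * => a2_moved.
  move=> dstE lt_src le_dst le_hole [le_depth depth_b le_sum full _].
  have lt_dst : dst m < src m by lia.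
  split=> //=; do 4 (move=> ? ->); rewrite -/(chunk m).
  have uE : chunk m = hole m - (depth m + hole m - b) by [].
  have := hole_size_le (dst m); have := hole_size_le (src m) => gs gd.
  split=> //; [lia|lia|lia|move=> v vE].
  split=> //; [lia|move=> a3 a3E].
  do 24 (move=> ? ->).
  have a3_bits c s : cell_bit a3 c s =
      if [&& c == src m, b - (depth m + chunk m) <= s & s < b - depth m]
      then cell_bit a1 c s else cell_bit a c s.
    rewrite a3E cell_bit_write (_ : b - _ + chunk m = b - depth m); last by lia.
    case: and3P => // -[/eqP-> le_s s_lt].
    (* The chunk is read from cell [dst m < src m], where nothing has been overwritten yet. *)
    rewrite vE bit_get -/(cell_bit a _ _) a_rest; last by rewrite /src_pos; lia.
    have lt_u : s - (b - (depth m + chunk m)) < chunk m by lia.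
    by rewrite lt_u a2_moved //; congr cell_bit; lia.
  have nextP := sched_nextP depth_b; rewrite /back_inv [sched_at k.+1]/= -/m.
  split.
  + by [].
  + by rewrite a3E; apply: is_array_write => //; lia.
  + move=> c s pos; rewrite a3_bits; case: and3P => [[/eqP cE le_s s_lt]|_].
      move: pos; rewrite /src_pos cE.
      by case: nextP => [[_ _ _ -> ->]|[_ ? [_ _ -> ->]]]; lia.
    apply: a_rest; move: pos; rewrite /src_pos.
    by case: nextP => [[_ _ _ -> ->]|[_ ? [_ _ -> ->]]]; lia.
  move=> c s lt_c lt_s pos; rewrite a3_bits; case: and3P => // Nsrc.
  apply: a_data => //; apply: contra pos; rewrite /src_pos.
  case: (eqVneq c (src m)) => [cE | ne_c].
    have {}Nsrc : ~~ ((b - (depth m + chunk m) <= s) && (s < b - depth m)).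
      by apply/negP => /andP[? ?]; apply: Nsrc; rewrite cE eqxx.
    by case: nextP => [[_ _ _ -> ->]|[_ ? [_ _ -> ->]]]; lia.
  case: nextP => [[_ _ _ -> ->]|[_ ? [_ _ -> ->]]]; first by lia.
  by case: (eqVneq c (src m - 1)) lt_s => [-> | ?] ?; lia.
- move=> rs a [-> _ _ _] /=.
  have [] := @sched_at_ok (n - 1); lia.
Qed.

Definition moved_back (rs a : seq nat) : Prop :=
  [/\ exists2 m, rs = sched_regs m & small nregs e rs, is_array n b a &
    forall c s, c < n -> s < b - hole_size c -> cell_bit a c s = cell_bit a1 c s].

Lemma move_back_triple :
  triple (move_segs copy_back)
    (fun rs a => rs = mkregs i 0 B 0 0 0 0 /\ a = a2)
    moved_back (51 * n).
Proof.
have [a2_arr a2_data _ _] := a2_out.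
suff loop_triple : triple [:: Loop (Reg rDst) (Reg rSrc) (move_body copy_back)]
    (fun rs a => rs = sched_regs (sched_at 0) /\ a = a2) moved_back (40 * n).
  have := triple_cons (@move_init_triple a2) loop_triple.
  by apply: triple_sub => //; lia.
apply: triple_sub back_triple => //.
- move=> _ _ [-> ->]; split=> // c s lt_c lt_s /negP[]; rewrite /src_pos /=.
  by case: (eqVneq c (n - 1)) lt_s => [-> | ?] ?; lia.
- move=> rs a [-> a_arr a_rest a_data]; split=> //.
    by eexists; first reflexivity; apply: sched_regs_small; lia.
  move=> c s lt_c lt_s; case: (boolP (src_pos (sched_at (n - 1)) c s)) => pos.
    by rewrite a_rest // a2_data // pos.
  exact: a_data.
Qed.

End Moves.

(** * Replacing the leading bits by counters and marked positions *)

Section Marks.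

Variable a0 : seq nat.
Hypotheses (a0_arr : is_array n b a0) (a0_sorted : sorted leq a0).

Definition high (c : nat) : nat := nth 0 a0 c %/ 2 ^ (b - t).
Definition top (c : nat) : nat := high c %/ 2 ^ (t - 3).
Definition below (i j : nat) : nat := count (fun c => top c <= j) (iota 0 i).

Lemma nth_a0_lt c : nth 0 a0 c < 2 ^ b.
Proof. by apply: lt_exp2_bit => s; apply: (cell_bit_ge _ a0_arr). Qed.

Lemma high_lt c : high c < 2 ^ t.
Proof. by rewrite /high ltn_divLR ?expn_gt0 // -expnD subnKC // nth_a0_lt. Qed.

Lemma top_le c : top c <= 7.
Proof.
by rewrite -ltnS /top ltn_divLR ?expn_gt0 // -pow3 high_lt.
Qed.

Lemma high_mono c c' : c <= c' -> c' < n -> high c <= high c'.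
Proof.
move=> le_c lt_c'; apply: leq_div2r.
have /andP[/eqP sz _] := a0_arr.
by apply: (sorted_leq_nth leq_trans leqnn) a0_sorted _ _ _ _ _; rewrite ?inE ?sz //; lia.
Qed.

Lemma top_mono c c' : c <= c' -> c' < n -> top c <= top c'.
Proof. by move=> le_c lt_c'; apply/leq_div2r/high_mono. Qed.

Lemma bit_high c s : bit (high c) s = cell_bit a0 c (b - t + s).
Proof. exact: bit_div. Qed.

Lemma belowS i j : below i.+1 j = below i j + (top i <= j).
Proof. by rewrite /below -addn1 iotaD count_cat /= addn0. Qed.

Lemma below_le i j : below i j <= i.
Proof. by rewrite /below -[leqRHS](size_iota 0) count_size. Qed.

(** As [top] is nondecreasing, the cells with digit at most [j] form an initial segment, of length
    [below n j]. *)
Lemma below_leP i j : i < n -> (below n j <= i) = (j < top i).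
Proof.
move=> lt_i; have [lt_j | le_top] := ltnP j (top i).
  rewrite /below -(subnKC (ltnW lt_i)) iotaD count_cat.
  suff /eqP-> : count (fun c => top c <= j) (iota (0 + i) (n - i)) == 0.
    by rewrite addn0; apply: below_le.
  rewrite eqn0Ngt -has_count; apply/hasPn => c; rewrite mem_iota -ltnNge => ?.
  by apply: leq_trans lt_j _; apply: top_mono; lia.
apply/negbTE; rewrite -ltnNge /below -(subnKC lt_i) iotaD count_cat ltn_addr //.
have /eqP-> // : count (fun c => top c <= j) (iota 0 i.+1) == i.+1.
rewrite -[X in _ == X](size_iota 0) -all_count; apply/allP => c.
rewrite mem_iota => ?; apply: leq_trans le_top; apply: top_mono; lia.
Qed.

Lemma sum_below i : i < n ->
  1 - (below n 0 - i) + (1 - (below n 1 - i)) + (1 - (below n 2 - i)) +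
  (1 - (below n 3 - i)) + (1 - (below n 4 - i)) + (1 - (below n 5 - i)) +
  (1 - (below n 6 - i)) = top i.
Proof.
move=> lt_i; have oneE j : 1 - (below n j - i) = (j < top i).
  by rewrite -below_leP //; lia.
by rewrite !oneE; have := top_le i; lia.
Qed.

(** The shift by three puts the freed bits at the low end of the leading field, so that the bits
    erased later form a hole at the most significant end of the cell. *)
Definition strip_inv (i : nat) (rs a : seq nat) : Prop :=
  [/\ rs = mkregs i 0 (below i) 0 0 0 0, is_array n b a &
    forall c s, c < n -> s < b -> cell_bit a c s =
      if (i <= c) || (s < b - t) then cell_bit a0 c s
      else (b - t + 3 <= s) && cell_bit a0 c (s - 3)].

Lemma strip_triple :
  triple [:: Loop (Reg rI) ArrayLen strip_body] (strip_inv 0) (strip_inv n)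
    (40 * n).
Proof.
apply: triple_sub (triple_loop (K := n) (I := strip_inv) _ _ _ _ _) => //=.
- by lia.
- by have := t_ge3; lia.
- move=> k rs a le_k [-> _ _]; apply: mkregs_small; try lia.
  by move=> j; apply: leq_trans (below_le k j) le_k.
- move=> i rs a lt_i [-> a_arr a_bits]; split=> //=.
  have -> : b - t + t = b by lia.
  split=> // h hE.
  have {hE} -> : h = high i.
    rewrite hE; apply: bit_ext => s; rewrite bit_get bit_high.
    case: ltnP => [lt_s | le_s] /=.
      by rewrite -/(cell_bit a i _) a_bits ?leqnn //; lia.
    by rewrite (cell_bit_ge _ a0_arr) //; lia.
  do 24 (move=> ? ->).
  split=> // a' a'E; do 4 (move=> ? ->).
  split.
  + have oneE j : 1 - (high i %/ 2 ^ (t - 3) - j) = (top i <= j).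
      by rewrite /top; lia.
    by rewrite /mkregs !oneE addn1 !belowS.
  + by rewrite a'E; apply: is_array_write => //; lia.
  move=> c s lt_c lt_s; rewrite a'E cell_bit_write.
  case: (eqVneq c i) => [-> | ne_ci] /=; last first.
    by rewrite a_bits // (_ : (i < c) = (i <= c)) //; lia.
  rewrite ltnn /= (_ : s < b - t + t); last by lia.
  case: (ltnP s (b - t)) => [lt_s' | le_s] /=.
    by rewrite a_bits // leqnn.
  rewrite (bit_mulX _ 3) bit_mod bit_high.
  rewrite (_ : 3 <= s - (b - t) = (b - t + 3 <= s)); last by lia.
  case: (leqP (b - t + 3) s) => //= le_s3; rewrite (_ : s - (b - t) - 3 < t - 3); last by lia.
  by congr cell_bit; lia.
- by move=> rs a [-> _ _] /=.
Qed.


(** The position of the one of index [c] in the Elias-Fano bit vector of the sorted sequence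
    [high]. *)
Definition code_pos (c : nat) : nat := c + high c.

Definition marked (i k : nat) : bool := has (fun c => code_pos c == k) (iota 0 i).

Lemma markedS i k : marked i.+1 k = marked i k || (code_pos i == k).
Proof. by rewrite /marked -addn1 iotaD has_cat /= orbF. Qed.

Lemma code_pos_lt c : c < n -> code_pos c < n + 2 ^ t - 1.
Proof. by rewrite /code_pos; have := high_lt c; have := n_le_pow; lia. Qed.

Lemma code_pos_mono c c' : c < c' -> c' < n -> code_pos c < code_pos c'.
Proof.
by move=> lt_c lt_c'; have := high_mono (ltnW lt_c) lt_c'; rewrite /code_pos; lia.
Qed.

Lemma markedP k : reflect (exists2 c, c < n & code_pos c = k) (marked n k).
Proof.
apply: (iffP hasP) => [[c] | [c lt_c /eqP eq_k]].
  by rewrite mem_iota => ? /eqP <-; exists c.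
by exists c; rewrite ?mem_iota.
Qed.

(** A mark may fall in a cell not yet reached, which is why all cells are stripped in an earlier
    pass. *)
Definition mark_inv (i : nat) (rs a : seq nat) : Prop :=
  [/\ rs = mkregs i 0 (below n) 0 0 0 0, is_array n b a &
    forall c s, c < n -> s < b -> cell_bit a c s =
      if s < b - t then cell_bit a0 c s
      else if s < b - t + 3 then marked i (c + n * (s - (b - t)))
      else (i <= c) && cell_bit a0 c (s - 3)].

Lemma low_read a i : i < n ->
    (forall s, b - t + 3 <= s -> s < b -> cell_bit a i s = cell_bit a0 i (s - 3)) ->
  get_field (nth 0 a i) (b - (t - 3)) (t - 3) = high i %% 2 ^ (t - 3).
Proof.
move=> lt_i low; apply: bit_ext => s.
rewrite bit_get bit_mod; case: ltnP => //= lt_s.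
rewrite -/(cell_bit a i _) low; [|lia|lia].
by rewrite bit_high; congr cell_bit; lia.
Qed.

Lemma high_join i : top i * 2 ^ (t - 3) + high i %% 2 ^ (t - 3) = high i.
Proof. by rewrite -divn_eq. Qed.

Lemma mark_triple :
  triple [:: Loop (Reg rI) ArrayLen mark_body] (mark_inv 0) (mark_inv n)
    (50 * n).
Proof.
apply: triple_sub (triple_loop (K := n) (I := mark_inv) _ _ _ _ _) => //=.
- by lia.
- by lia.
- move=> k rs a le_k [-> _ _]; apply: mkregs_small; try lia.
  by move=> j; apply: below_le.
- move=> i rs a lt_i [-> a_arr a_bits]; split=> //= ? ->.
  have offE : b - (t - 3) + (t - 3) = b by lia.
  split=> //; [lia|lia|move=> low lowE].
  have {lowE} -> : low = high i %% 2 ^ (t - 3).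
    rewrite lowE; apply: low_read => // s le_s lt_s.
    by rewrite a_bits // leqnn ifN ?ifN //; lia.
  do 27 (move=> ? ->).
  have k_lt := code_pos_lt lt_i; have := pow_lt_2n => N_lt.
  rewrite subnn add0n sum_below // high_join (addnC (high i)) -/(code_pos i).
  set k := code_pos i in k_lt *.
  (* Positions are below [n + 2 ^ t - 1], hence below [3 * n]: three planes suffice. *)
  have lt_pl : k %/ n <= 2 by rewrite -ltnS ltn_divLR; lia.
  split=> //; [lia| move=> a1 a1E ? ->].
  have -> : b - (t - k %/ n) = b - t + k %/ n.
    by move: (k %/ n) lt_pl => pl lt_pl; lia.

  split; [by rewrite ltn_mod; lia|lia|move=> a2 a2E].
  do 5 (move=> ? ->); split.
  + by rewrite /mkregs addn1.
  + rewrite a2E; apply: is_array_write; [|by rewrite ltn_mod; lia|lia].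
    by rewrite a1E; apply: is_array_write => //; lia.
  move=> c s lt_c lt_s; rewrite a2E cell_bit_write a1E cell_bit_write.
  rewrite bit0 bit1 markedS -/k a_bits // {a_bits a1E a2E a1 a2}.
  (* By Euclidean division by [n], a position has a single cell and plane, so that the write adds
     exactly one mark. *)
  have -> : (k == c + n * (s - (b - t))) = (c == k %% n) && (s - (b - t) == k %/ n).
    apply/eqP/andP => [-> | [/eqP-> /eqP->]]; last by rewrite addnC mulnC -divn_eq.
    by rewrite mulnC addnC modnMDl modn_small // divnMDl ?divn_small //; [lia|lia].
  move: (k %/ n) (k %% n) lt_pl => pl r lt_pl {k k_lt N_lt}.
  case: (ltnP s (b - t)) => [lt_s' | le_s].
    by do 2 (case: and3P => [[]|_]; first by lia).
  case: (ltnP s (b - t + 3)) => [lt_s' | le_s'].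
    rewrite [X in if _ then _ else X](_ : _ = marked i (c + n * (s - (b - t)))); last first.
      by case: and3P => [[]|//]; lia.
    case: (eqVneq c r) => /= [_|_]; last by rewrite orbF.
    case: (eqVneq (s - (b - t)) pl) => [eq_pl | ne_pl].
      by case: andP => [_|[]]; rewrite ?orbT; lia.
    by rewrite orbF; case: andP => [[]|//]; lia.
  case: and3P => [[]|_]; first by lia.
  case: (eqVneq c i) => [-> | ne_ci] /=; last by congr (_ && _); lia.
  by rewrite ltnn; case: andP => // -[]; lia.
- by move=> rs a [-> _ _] /=.
Qed.

Definition is_marked (a : seq nat) : Prop :=
  is_array n b a /\ forall c s, c < n -> s < b -> cell_bit a c s =
    if s < b - t then cell_bit a0 c s
    else (s < b - t + 3) && marked n (c + n * (s - (b - t))).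

(** Only plane 2 of the cells [c >= 2 ^ t - n] is in question; it stands for positions
    [c + 2 * n >= n + 2 ^ t], which no [code_pos] reaches. *)
Lemma is_marked_hole a : is_marked a -> forall c s,
  c < n -> s < b -> b - hole_size c <= s -> cell_bit a c s = false.
Proof.
move=> [_ a_bits] c s lt_c lt_s; rewrite hole_sizeE => le_s.
have ? := n_le_pow.
rewrite a_bits // ifN; last by lia.
case: ltnP => //= lt_s3; apply/negbTE/negP => /markedP[c' lt_c' posE].
have := code_pos_lt lt_c'; rewrite posE.
have -> : s - (b - t) = 2 by lia.
by lia.
Qed.

Definition compressed (a2 : seq nat) : Prop :=
  exists2 a1, is_marked a1 & moved_out a1 a2.

Lemma compress_triple :
  triple compress_segs (fun rs a => rs = [::] /\ a = a0)
    (fun _ a => compressed a) (160 * n).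
Proof.
apply: (@triple_sub _ _ _ _ _ (fun rs a => rs = [::] /\ a = a0) _
   (fun _ a => compressed a) _
   (7 * n + (40 * n + (1 + (50 * n + 51 * n))))) => //; first by lia.
apply: triple_cat (@prelude_triple a0) _.
apply: (triple_cons (M := strip_inv n)).
  apply: triple_sub strip_triple => // _ _ [-> ->]; split=> // c s _ _.
apply: (triple_cons (M := mark_inv 0)).
  apply: triple_block => //=; first by lia.
  move=> rs a [-> a_arr a_bits]; split.
    by apply: mkregs_small => //; [lia | exact: below_le n].
  move=> /= v ->; split=> // c s lt_c lt_s; rewrite a_bits // leqNgt lt_c /=.
  by case: ltnP => //= _; case: ltnP.
apply: (triple_cons (M := mark_inv n)); first exact: mark_triple.
apply: triple_pointwise => _ a1 [-> a1_arr a1_bits].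
have a1_marked : is_marked a1.
  split=> // c s lt_c lt_s; rewrite a1_bits //; case: ltnP => // _.
  by case: ltnP => //= _; rewrite leqNgt lt_c.
have n_le : n <= 4 * n by lia.
have := @move_out_triple a1 n (below n) n_le (below_le n) a1_arr (is_marked_hole a1_marked).
by apply: triple_sub => // rs a a_out; exists a1.
Qed.

(** * Recovering the leading bits from the marks *)

Section Decode.

Variable a3 : seq nat.
Hypothesis a3_bits : forall c s, c < n -> s < b - hole_size c ->
  cell_bit a3 c s =
  if s < b - t then cell_bit a0 c s else marked n (c + n * (s - (b - t))).

(** The witness [i], the number of cells decoded, is the number of marks below [k]. Decoding writes
    only above the three planes, so the marks still to be read stay intact. *)
Definition decode_inv (k : nat) (rs a : seq nat) : Prop :=
  exists i, [/\ rs = mkregs i k (below i) 0 0 0 0 /\ is_array n b a, i <= n,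
    forall c, c < i -> code_pos c < k,
    forall c, i <= c -> c < n -> k <= code_pos c &
    (forall c s, s < b - t + 3 -> cell_bit a c s = cell_bit a3 c s) /\
    (forall c s, c < i -> b - t + 3 <= s -> s < b ->
      cell_bit a c s = cell_bit a0 c (s - 3))].

Lemma get_field1 x off : get_field x off 1 = bit x off.
Proof. by rewrite /get_field expn1 modn2. Qed.

(** If [k] lies in plane 2, its cell is below [2 ^ t - n], and the hole of that cell starts above
    the plane. *)
Lemma marked_read k : k < n + 2 ^ t - 1 ->
  cell_bit a3 (k %% n) (b - t + k %/ n) = marked n k.
Proof.
move=> lt_k; have n_gt0 : 0 < n by lia.
have lt_c : k %% n < n by rewrite ltn_mod.
rewrite a3_bits //.
  by rewrite ltnNge leq_addr addKn [n * _]mulnC [_ %% n + _]addnC -divn_eq.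
rewrite hole_sizeE; have := pow_lt_2n; move: lt_k; rewrite {1}(divn_eq k n).
move: (k %/ n) (k %% n) lt_c => pl c lt_c lt_k lt_2n.
have le_pl : pl <= 2 by nia.
case: pl le_pl lt_k => [|[|[|pl]]] // _ lt_k; lia.
Qed.

Lemma decode_triple :
  triple [:: Loop (Reg rI) ArrayLen decode_body]
    (decode_inv 0) (decode_inv (code_pos (n - 1)).+1) (150 * n).
Proof.
have last_pos : code_pos (n - 1) < n + 2 ^ t - 1 by apply: code_pos_lt; lia.
have ? := pow_lt_2n; have ? := n_le_pow.
(* The scan ends just after the last mark, in fewer than [3 * n] iterations. *)
pose K := (code_pos (n - 1)).+1.
apply: triple_sub (triple_loop (K := K) (I := decode_inv) _ _ _ _ _) => //=.
- by lia.
- by lia.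
- move=> k rs a le_k [i [[-> _] le_i _ _ _]]; apply: mkregs_small; try lia.
  by move=> j; apply: leq_trans (below_le i j) le_i.
- move=> k rs a lt_k [i [[-> a_arr] le_i pos_lt pos_ge [a_data a_low]]].
  have lt_i : i < n.
    rewrite ltnNge; apply/negP => ge_i; have := pos_lt (n - 1); lia.
  have k_lt : k < n + 2 ^ t - 1 by lia.
  split=> //=; do 4 (move=> ? ->).
  have le_pl : k %/ n <= 2 by rewrite -ltnS ltn_divLR; lia.
  have -> : b - (t - k %/ n) = b - t + k %/ n.
    by move: (k %/ n) le_pl => pl; lia.
  split; [by rewrite ltn_mod; lia|by move: (k %/ n) le_pl => pl; lia|lia|].
  move=> m; rewrite get_field1 -/(cell_bit _ _ _) a_data; last first.
    by move: (k %/ n) le_pl => pl; lia.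
  rewrite marked_read // => -> {m} ? -> ? ->.
  split=> //; [lia|move=> a' a'E].
  do 29 (move=> ? ->).
  (* [code_pos] is strictly increasing, so the first mark at or after [k] is that of cell [i]. *)
  have markE : marked n k = (code_pos i == k).
    apply/markedP/eqP => [[c lt_c posE] | posE]; last by exists i.
    have [lt_ci | lt_ic | <- //] := ltngtP c i.
      by have := pos_lt c lt_ci; lia.
    by have := code_pos_mono lt_ic lt_c; have := pos_ge i (leqnn i) lt_i; lia.
  have a'_arr : is_array n b a' by rewrite a'E; apply: is_array_write => //; lia.
  have a'_data c s : s < b - t + 3 -> cell_bit a' c s = cell_bit a3 c s.
    move=> lt_s; rewrite a'E cell_bit_write; case: and3P => [[]|_]; first by lia.
    exact: a_data.
  have a'_low c s : c < i -> b - t + 3 <= s -> s < b ->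
      cell_bit a' c s = cell_bit a0 c (s - 3).
    move=> lt_c le_s lt_s; rewrite a'E cell_bit_write.
    by case: and3P => [[/eqP]|_]; [lia | exact: a_low].
  rewrite markE; case: eqP => [posE | ne_pos] /=; last first.
    exists i; split=> //; first by rewrite !addn0 addn1.
      by move=> c lt_c; have := pos_lt c lt_c; lia.
    move=> c le_c lt_c; have [-> | ne_c] := eqVneq c i.
      by have := pos_ge i (leqnn i) lt_i; lia.
    have lt_ic : i < c by lia.
    by have := code_pos_mono lt_ic lt_c; have := pos_ge i (leqnn i) lt_i; lia.
  (* The number of marks already passed is [i]; subtracting it from the position leaves the leading
     bits. *)
  have hE : k - i = high i by rewrite -posE /code_pos addKn.
  exists i.+1; split=> //.
  + split=> //; have oneE j : 1 - ((k - i) %/ 2 ^ (t - 3) - j) = (top i <= j).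
      by rewrite hE /top; lia.
    by rewrite /mkregs !oneE !addn1 !belowS.
  + by move=> c; rewrite ltnS leq_eqVlt => /predU1P[-> | /pos_lt]; lia.
  + by move=> c lt_ic lt_c; have := code_pos_mono lt_ic lt_c; lia.
  split=> // c s; rewrite ltnS leq_eqVlt => /predU1P[-> | lt_c] le_s lt_s; last exact: a'_low.
  rewrite a'E cell_bit_write eqxx hE; case: andP => [_ | []]; last by lia.
  rewrite bit_mod bit_high (_ : _ < t - 3); last by lia.
  by congr cell_bit; lia.
- move=> rs a [i [[-> _] le_i _ pos_ge _]] /=; rewrite leqNgt; apply/negP => lt_i.
  by have := pos_ge (n - 1); lia.
Qed.

Definition restore_inv (i : nat) (rs a : seq nat) : Prop :=
  [/\ rs = mkregs i 0 (below n) 0 0 0 0, is_array n b a,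
    forall c s, c < n -> s < b -> (c < i) || (s < b - t) ->
      cell_bit a c s = cell_bit a0 c s &
    forall c s, i <= c -> c < n -> b - t + 3 <= s -> s < b ->
      cell_bit a c s = cell_bit a0 c (s - 3)].

Lemma restore_triple :
  triple [:: Loop (Reg rI) ArrayLen restore_body]
    (restore_inv 0) (restore_inv n) (50 * n).
Proof.
apply: triple_sub (triple_loop (K := n) (I := restore_inv) _ _ _ _ _) => //=.
- by lia.
- by lia.
- move=> k rs a le_k [-> _ _ _]; apply: mkregs_small; try lia.
  by move=> j; apply: below_le.
- move=> i rs a lt_i [-> a_arr a_done a_low]; split=> //= ? ->.
  split=> //; [lia|lia|move=> low lowE].
  have {lowE} -> : low = high i %% 2 ^ (t - 3).
    by rewrite lowE; apply: low_read => // s le_s lt_s; apply: a_low.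
  do 24 (move=> ? ->).
  rewrite subnn add0n sum_below // high_join.
  split=> //; [lia|move=> a' a'E]; do 5 (move=> ? ->); split.
  + by rewrite /mkregs addn1.
  + by rewrite a'E; apply: is_array_write => //; lia.
  + move=> c s lt_c lt_s; rewrite a'E cell_bit_write.
    case: and3P => [[/eqP-> le_s _] _ | N].
      by rewrite bit_high; congr cell_bit; lia.
    move=> cs; apply: a_done => //; apply/negP => Ncs; apply: N.
    by split; [apply/eqP|..]; lia.
  + move=> c s lt_ic lt_c le_s lt_s; rewrite a'E cell_bit_write.
    by case: and3P => [[/eqP]|_]; [lia | apply: a_low; lia].
- by move=> rs a [-> _ _ _] /=.
Qed.

End Decode.

Lemma decompress_triple a2 : compressed a2 ->
  triple decompress_segs (fun rs a => rs = [::] /\ a = a2)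
    (fun _ a => a = a0) (300 * n).
Proof.
case=> a1 a1_marked a2_out; have [a1_arr a1_bits] := a1_marked.
have last_pos : code_pos (n - 1) < n + 2 ^ t - 1 by apply: code_pos_lt; lia.
have ? := pow_lt_2n; have ? := n_le_pow.
apply: (@triple_sub _ _ _ _ _ (fun rs a => rs = [::] /\ a = a2) _
   (fun _ a => a = a0) _
   (7 * n + (51 * n + (4 + (150 * n + (2 + 50 * n)))))) => //; first by lia.
apply: triple_cat (@prelude_triple a2) _.
apply: triple_cat (@move_back_triple a1 0 (fun=> 0) _ _ a1_arr a2 a2_out) _ => //.
apply: triple_pointwise => rs a3 [[m rsE rs_small] a3_arr a3_data].
have a3_bits c s : c < n -> s < b - hole_size c -> cell_bit a3 c s =
    if s < b - t then cell_bit a0 c s else marked n (c + n * (s - (b - t))).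
  move=> lt_c lt_s; rewrite a3_data // a1_bits //; last by lia.
  by rewrite (_ : s < b - t + 3) //; move: lt_s; rewrite hole_sizeE; lia.
apply: (triple_cons (M := decode_inv a3 0)).
  apply: triple_block => //=; first by lia.
  move=> _ _ [-> ->]; split=> //; rewrite rsE /=; do 4 (move=> ? ->).
  by exists 0; split.
apply: triple_cons (decode_triple a3_bits) _.
apply: (triple_cons (M := restore_inv 0)).
  apply: triple_block => //=; first by lia.
  move=> rs' a [i [[-> a_arr] le_i _ pos_ge [a_data a_low]]].
  (* The last mark has been passed, so every cell has been decoded. *)
  have {le_i} iE : i = n.
    apply/eqP; rewrite eqn_leq le_i leqNgt; apply/negP => lt_i.
    by have := pos_ge (n - 1); lia.
  subst i; split.
    by apply: mkregs_small => //; [lia | lia | exact: below_le n].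
  move=> /= ? -> ? ->; split=> // [c s lt_c lt_s /= lt_st | c s _ lt_c le_s lt_s].
    rewrite a_data; last by lia.
    by rewrite a3_bits ?lt_st //; rewrite hole_sizeE; lia.
  exact: a_low.
apply: triple_sub restore_triple => // rs' a [_ a_arr a_done _].
by apply: is_array_ext a_arr a0_arr _ => c s lt_c lt_s; rewrite a_done ?lt_c.
Qed.

End Marks.

Lemma compressed_format a0 a : is_array n b a0 -> sorted leq a0 ->
  compressed a0 a -> compact_format n b a.
Proof.
move=> a0_arr a0_sorted [a1 a1_marked a_out]; split; first by case: a_out.
have [a1_arr _] := a1_marked.
have zero := moved_out_zero a_out.
(* Fewer trailing zeros are a weaker demand; it remains to compare the spare bits with the total
   size of the holes, by AM-GM. *)
move=> q /andP[q_ge q_lt]; apply: zero; rewrite q_lt andbT.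
apply: leq_trans q_ge; apply: leq_sub2l; rewrite sum_hole_size /spare_bits /lg_ceil.
have le_n := n_le_pow; have lt_2n := pow_lt_2n.
by have := up_log_exp_le (ltnW lt_2n) le_n; lia.
Qed.

End Passes.

(** * The round trip and its cost *)

Lemma transforms_within_le p n b T T' S S' a a' : T <= T' -> S <= S' ->
  transforms_within p n b T S a a' -> transforms_within p n b T' S' a a'.
Proof.
move=> le_T le_S [k [le_k fin sp]]; exists k; split=> //; first exact: leq_trans le_T.
by move=> j c le_j /(sp j c le_j)/leq_trans; apply.
Qed.

Lemma sorted_list_array n m a : sorted_list n m a -> is_array n (lg_ceil m) a.
Proof.
move=> /and3P[sz lt_m _]; rewrite /is_array sz; apply: sub_all lt_m => x /leq_trans.
by apply; apply: up_logP.
Qed.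

(** For [n <= 4] one has [n ^ n <= 4 ^ n], so the logarithm is at most [2 * n]. *)
Lemma spare_bits_small n : n < 5 -> spare_bits n = 0.
Proof. by case: n => [|[|[|[|[|n]]]]]. Qed.

(** 22 registers of [60 * t] bits each; the running times, at most [300 * n + 1], are well below. *)
Definition factor : nat := 1320.

Lemma round_trip n m a : let b := lg_ceil m in
    0 < n -> n <= 2 ^ b -> sorted_list n m a -> exists a',
  [/\ compact_format n b a',
    transforms_within (guarded_program compress_segs) n b (factor * n)
      (factor * lg_ceil n) a a' &
    transforms_within (guarded_program decompress_segs) n b (factor * n)
      (factor * lg_ceil n) a' a].
Proof.
move=> b n_gt0 le_n a_list; have a_arr := sorted_list_array a_list.
have /and3P[_ _ a_sorted] := a_list.
have [n_lt5 | n_gt4] := ltnP n 5.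
  exists a; split; last 2 first.
  - by apply: guarded_program_small => //; rewrite /factor; lia.
  - by apply: guarded_program_small => //; rewrite /factor; lia.
  by split=> // q; rewrite spare_bits_small // subn0; lia.
have le_tb : lg_ceil n <= b by apply: up_log_min.
have le_space : 22 * (60 * lg_ceil n) <= factor * lg_ceil n.
  by rewrite mulnA leq_mul2r orbC.
have [a' [a'_comp run_c]] :=
  guarded_program_big n_gt4 (@compress_triple _ _ _ n_gt4 erefl le_tb _ a_arr a_sorted).
have [_ [-> run_d]] := guarded_program_big n_gt4
  (@decompress_triple _ _ _ n_gt4 erefl le_tb _ a_arr a_sorted _ a'_comp).
exists a'; split; first exact: compressed_format a'_comp.
  by apply: transforms_within_le le_space run_c; rewrite /factor; lia.
by apply: transforms_within_le le_space run_d; rewrite /factor; lia.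
Qed.

Theorem theorem5 :
  exists (compact : nat -> nat -> seq nat -> seq nat)
         (compress decompress : program) (C : nat),
  forall n m : nat,
    let b := lg_ceil m in
    0 < n -> n <= 2 ^ b ->
    [/\ forall a, sorted_list n m a -> compact_format n b (compact n m a),
        {in sorted_list n m &, injective (compact n m)},
        forall a, sorted_list n m a ->
          transforms_within compress n b (C * n) (C * lg_ceil n)
            a (compact n m a) &
        forall a, sorted_list n m a ->
          transforms_within decompress n b (C * n) (C * lg_ceil n)
            (compact n m a) a].
Proof.
exists (fun n m => final_cells (guarded_program compress_segs) n (lg_ceil m) (factor * n)).
exists (guarded_program compress_segs), (guarded_program decompress_segs), factor.
move=> n m b n_gt0 le_n.
have trip a : sorted_list n m a ->
    let a' := final_cells (guarded_program compress_segs) n (lg_ceil m) (factor * n) a in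
  [/\ compact_format n b a',
    transforms_within (guarded_program compress_segs) n b (factor * n)
      (factor * lg_ceil n) a a' &
    transforms_within (guarded_program decompress_segs) n b (factor * n)
      (factor * lg_ceil n) a' a].
  move=> /(round_trip n_gt0 le_n)[a' [fmt run_c run_d]].
  by rewrite /= (final_cellsE run_c).
split=> [a /trip[] //| a a' /trip[_ _ run_a] /trip[_ _ run_a'] eq_aa' | a /trip[] // | a /trip[] //].
(* Decompression is deterministic, so equal compact forms come from equal lists. *)
by rewrite -(final_cellsE run_a) -(final_cellsE run_a') eq_aa'.
Qed.
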